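(* (i) For $6\le n\le 12$: $\mathrm{ex}_3(n;P\mid M)=20+\binom{n-6}{3}$ and $\mathrm{Ex}_3(n;P\mid M)=\{K^3_6\cup K^3_{n-6}\}$. (ii) For $n=13$: $\mathrm{ex}_3(13;P\mid M)=40$ and $\mathrm{Ex}_3(13;P\mid M)=\{K^3_6\cup K^3_6\cup K^3_1,\ \mathrm{Co}(13)\}$. (iii) For $n\ge 14$: $\mathrm{ex}_3(n;P\mid M)=4+\binom{n-4}{2}$ and $\mathrm{Ex}_3(n;P\mid M)=\{\mathrm{Co}(n)\}$.
   Context: All hypergraphs are 3-uniform; containment means containing an isomorphic copy. $P$ is the loose 3-uniform path of length 3: vertices $a,b,c,d,e,f,g$, edges $\{a,b,c\},\{c,d,e\},\{e,f,g\}$. $M$ is the 3-graph consisting of two disjoint edges. $K^3_m$ is the complete 3-graph on $m$ vertices ($K^3_0$ is empty, $K^3_1$ an isolated vertex) and $\cup$ denotes vertex-disjoint union. The comet $\mathrm{Co}(n)$ is the $n$-vertex 3-graph with vertex set $\{c,h_1,h_2,h_3\}\cup R$, $|R|=n-4$, whose edges are the four triples of $\{c,h_1,h_2,h_3\}$ together with all triples $\{c,u,v\}$ with $u,v\in R$. Conditional Turán number: for a family $\mathcal F$ and a family $\mathcal G$ of $\mathcal F$-free 3-graphs, $\mathrm{ex}_3(n;\mathcal F\mid\mathcal G)$ is the maximum number of edges of an $n$-vertex $\mathcal F$-free 3-graph $H$ that contains some $G\in\mathcal G$; $\mathrm{Ex}_3(n;\mathcal F\mid\mathcal G)$ is the family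 (up to isomorphism) of such $H$ attaining this maximum. *)

(* Defs.v *)
From mathcomp Require Import all_boot.
Set Implicit Arguments. Unset Strict Implicit. Unset Printing Implicit Defensive.

Definition uniform3 (n : nat) (H : {set {set 'I_n}}) : Prop :=
  forall e, e \in H -> #|e| = 3.

Definition contains (V : finType) (n : nat) (F : {set {set V}})
  (H : {set {set 'I_n}}) : Prop :=
  exists f : V -> 'I_n, injective f /\ forall e, e \in F -> f @: e \in H.

Definition iso (n : nat) (G H : {set {set 'I_n}}) : Prop :=
  exists f : 'I_n -> 'I_n, injective f /\ H = [set f @: e | e : {set 'I_n} in G].

Definition Ppath : {set {set 'I_7}} :=
  [set [set (inord 0 : 'I_7); inord 1; inord 2];
       [set (inord 2 : 'I_7); inord 3; inord 4];
       [set (inord 4 : 'I_7); inord 5; inord 6]].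

Definition Mmatch : {set {set 'I_6}} :=
  [set [set (inord 0 : 'I_6); inord 1; inord 2];
       [set (inord 3 : 'I_6); inord 4; inord 5]].

Definition Pfree (n : nat) (H : {set {set 'I_n}}) : Prop := ~ contains Ppath H.

Definition K6_Kn6 (n : nat) : {set {set 'I_n}} :=
  [set e : {set 'I_n} | (#|e| == 3) &&
     ((e \subset [set i : 'I_n | i < 6]) || (e \subset [set i : 'I_n | 6 <= i]))].

Definition K6_K6_K1 : {set {set 'I_13}} :=
  [set e : {set 'I_13} | (#|e| == 3) &&
     ((e \subset [set i : 'I_13 | i < 6]) ||
      (e \subset [set i : 'I_13 | 6 <= i < 12]))].

(* Comet Co(n): c = 0, h1,h2,h3 = 1,2,3, R = {4..n-1}. *)
Definition comet (n : nat) : {set {set 'I_n}} :=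
  [set e : {set 'I_n} | (#|e| == 3) &&
     ((e \subset [set i : 'I_n | i < 4]) ||
      ([exists i in e, val i == 0] &&
       (e \subset [set i : 'I_n | (val i == 0) || (4 <= i)])))].

(* Main.v *)
Require Import Defs.
From mathcomp Require Import all_boot zify.
Set Implicit Arguments. Unset Strict Implicit. Unset Printing Implicit Defensive.

(** Call a 6-set dense if it spans at least 15 edges. In a [P]-free graph a dense 6-set
    spans two disjoint edges, and an edge leaving it would kill too many of its triples;
    so it is a union of components, and the rest is bounded separately. In a graph
    without dense 6-sets and containing [M], either intersecting edges form an
    equivalence relation, so that the graph splits into two vertex-disjoint parts, or
    some edge meets two disjoint edges, which forces [abp], [abc], [cuv]. If moreover
    [cxy] is an edge, then almost all edges meeting [{a,b,p}] lie in [{a,b,c,p}]: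
    deleting [{a,b,p}] or [{a,b}] gives the comet or an induction with room to spare.
    Otherwise the edges leaving [{a,b,p,c,u,v}] are so restricted that the number of
    edges is too small. Parts without [M] are intersecting families. *)

(** * Paths among labelled vertices *)

(** An induction on the target value itself would have no slack: after two or three vertices are
    deleted the remainder may again be extremal. Hence dense 6-sets are removed beforehand, and
    comets are kept as an alternative to the bound [gb]. This [gb] lies below [20 + 'C(n - 6, 3)]
    for [6 <= n <= 12] and equals [3 + 'C(n - 4, 2)], one less than the comet, from 13 on; this
    explains the recurring correction [12 < m]. The entries of [ub] are ['C(k, 3)] up to five
    vertices, 14 for a sparse 6-set, 17 by averaging over 6-sets, and 24 and 29 for intersecting
    families without a common vertex; from 10 vertices on a star is larger. The local claims concern
    few vertices but many cases. An arbitrary edge is seen through its trace on the labelled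
    vertices, its other vertices get fresh labels, and all traces are tested by computation; bounds
    on the number of edges within six labelled vertices come from a search that branches on the
    presence of each triple. *)

Definition common (e f : seq nat) := count [in f] e.

(** The [if] keeps call-by-value evaluation from searching for the third edge when the first two do
    not share exactly one vertex. *)
Definition has_path (L : seq (seq nat)) :=
  has (fun e => has (fun f => if common e f == 1 then
    has (fun g => (common f g == 1) && (common e g == 0)) L else false) L) L.

Definition wf_edge n (t : seq nat) := [&& size t == 3, uniq t & all (ltn^~ n) t].

Fixpoint masks n : seq bitseq :=
  if n is n'.+1 then [seq b :: m | b <- [:: true; false], m <- masks n'] else [:: [::]].

Lemma mem_masks (m : bitseq) : m \in masks (size m).
Proof.
elim: m => [|b m IH] //.
by apply/allpairsP; exists (b, m); split=> //; case: b.
Qed.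

(* The index triple of an edge whose intersection with [n] labelled vertices
   has mask [m], its other vertices being labelled [n], [n + 1], ... *)
Definition mask_idx (m : bitseq) := [seq i <- iota 0 (size m) | nth false m i].
Definition pattern (m : bitseq) :=
  mask_idx m ++ iota (size m) (3 - size (mask_idx m)).

(* [few fuel k L ts]: if the edges labelled by [L] are present, then at most
   [k] of the triples [ts] can be present. *)
Fixpoint few fuel k L ts :=
  if size ts <= k then true else
  if fuel is fuel'.+1 then
    if ts is t :: ts' then
      if few fuel' k L ts' then
        if has_path (t :: L) then true else
        if k is k'.+1 then
          few fuel' k' (t :: L) [seq t' <- ts' | ~~ has_path [:: t', t & L]]
        else false
      else false
    else true
  else false.

Definition triples n := [seq mask_idx m | m <- masks n & count id m == 3].

(** Fuel [size ts] suffices, since every recursive call drops the head of its list. *)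
Definition few_inside n k L :=
  let ts := [seq t <- triples n | ~~ has_path (t :: L)] in few (size ts) k L ts.

Lemma wf_edge_le n m t : n <= m -> wf_edge n t -> wf_edge m t.
Proof.
move=> nm /and3P[t3 ut /allP b]; rewrite /wf_edge t3 ut.
by apply/allP=> i /b /= lin; apply: leq_trans nm.
Qed.

Section Graphs.
Variable T : finType.
Implicit Types (H : {set {set T}}) (e f g S V W X : {set T}) (s : seq T).

Definition uni3 H := forall e, e \in H -> #|e| = 3.

(** In a 3-uniform graph these intersection sizes force seven distinct vertices, so this is freeness
    from the loose path, phrased by counting alone. *)
Definition path_free H := forall e f g, e \in H -> f \in H -> g \in H ->
  #|e :&: f| = 1 -> #|f :&: g| = 1 -> #|e :&: g| <> 0.

Definition inside H S : {set {set T}} := [set e in H | e \subset S].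

Section Labels.
Variables (x0 : T) (H : {set {set T}}).
Hypotheses (uH : uni3 H) (pH : path_free H).

Definition edge s (t : seq nat) : {set T} :=
  [set nth x0 s (nth 0 t 0); nth x0 s (nth 0 t 1); nth x0 s (nth 0 t 2)].

Lemma edgeE n s t : wf_edge n t -> edge s t = [set x in [seq nth x0 s i | i <- t]].
Proof.
case/and3P=> + _ _; case: t => [|i [|j [|k []]]] //= _.
by apply/setP=> x; rewrite !inE orbA.
Qed.

(** Distinct labels name distinct vertices, so paths can be recognised on labels; all computed
    checks rest on this. *)
Lemma card_edgeI s t t' : uniq s -> wf_edge (size s) t -> wf_edge (size s) t' ->
  #|edge s t :&: edge s t'| = common t t'.
Proof.
move=> us wt wt'; rewrite (edgeE s wt) (edgeE s wt').
case/and3P: wt => _ ut /allP /= bt; case/and3P: wt' => _ _ /allP /= bt'.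
have -> : [set x in [seq nth x0 s i | i <- t]] :&:
          [set x in [seq nth x0 s i | i <- t']] =
          [set x in [seq nth x0 s i | i <- t & i \in t']].
  apply/setP=> x; rewrite !inE; apply/andP/mapP.
    case=> /mapP[i it ->] /mapP[j jt' /eqP].
    rewrite nth_uniq // ?(bt _ it) ?(bt' _ jt') // => /eqP ij.
    by exists i => //; rewrite mem_filter it ij jt'.
  case=> i; rewrite mem_filter => /andP[it' it] ->.
  by rewrite !map_f.
rewrite cardsE /common -size_filter -(size_map (nth x0 s)).
apply/card_uniqP; rewrite map_inj_in_uniq ?filter_uniq // => i j.
rewrite !mem_filter => /andP[_ it] /andP[_ jt] /eqP.
by rewrite nth_uniq // ?(bt _ it) ?(bt _ jt) // => /eqP.
Qed.

Definition known s L := all (fun t => wf_edge (size s) t && (edge s t \in H)) L.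

Lemma known_cons s t L :
  known s (t :: L) = [&& wf_edge (size s) t, edge s t \in H & known s L].
Proof. by rewrite andbA. Qed.

Lemma known_path s L : uniq s -> known s L -> ~~ has_path L.
Proof.
move=> us /allP kL; apply/negP=> /hasP[t1 /kL/andP[w1 h1]] /hasP[t2 /kL/andP[w2 h2]].
case: eqP => // c12 /hasP[t3 /kL/andP[w3 h3]] /andP[/eqP c23 /eqP c13].
apply: (pH h1 h2 h3); by rewrite card_edgeI.
Qed.

Lemma known_cat s r L : known s L -> known (s ++ r) L.
Proof.
move=> /allP kL; apply/allP=> t /kL/andP[/and3P[s3 ut bt] ht].
have bt' : all (ltn^~ (size (s ++ r))) t.
  by apply/allP=> i /(allP bt) /= lis; rewrite size_cat ltn_addr.
rewrite /wf_edge s3 ut bt' /=.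
suff -> : edge (s ++ r) t = edge s t by [].
case: t s3 bt {ut ht bt'} => [|i [|j [|k []]]] //= _ /and4P[bi bj bk _].
by rewrite /edge /= !nth_cat bi bj bk.
Qed.

Definition outer s e := enum (e :\: [set x in s]).
Definition emask s e : bitseq := [seq x \in e | x <- s].

Lemma mask_idxE s e :
  [seq nth x0 s i | i <- mask_idx (emask s e)] = [seq x <- s | x \in e].
Proof.
rewrite /mask_idx size_map.
have -> : [seq i <- iota 0 (size s) | nth false (emask s e) i] =
          [seq i <- iota 0 (size s) | nth x0 s i \in e].
  apply: eq_in_filter => i; rewrite mem_iota /= => lis.
  by rewrite (nth_map x0).
rewrite -(filter_map (nth x0 s) (mem e)); congr filter.
by rewrite -/(mkseq _ _) mkseq_nth.
Qed.

Lemma uniq_outer s e : uniq s -> uniq (s ++ outer s e).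
Proof.
move=> us; rewrite cat_uniq us enum_uniq andbT /=.
by apply/hasPn=> x; rewrite mem_enum !inE => /andP[].
Qed.

Lemma size_outer s e : uniq s -> #|e| = 3 ->
  size (mask_idx (emask s e)) + size (outer s e) = 3.
Proof.
move=> us e3; rewrite -(size_map (nth x0 s)) mask_idxE -cardE -e3.
rewrite -(cardsID [set x in s] e); congr addn.
rewrite -(card_uniqP _) ?filter_uniq //; apply: eq_card => x.
by rewrite mem_filter !inE.
Qed.

(** The vertices of [e] outside [s] are appended to the label list, which is what entitles [pattern]
    to the next fresh labels. *)
Lemma known_pattern s e : uniq s -> e \in H ->
  known (s ++ outer s e) [:: pattern (emask s e)].
Proof.
move=> us eH; rewrite /known /= andbT.
have e3 := uH eH; have so := size_outer us e3.
have sp : size (pattern (emask s e)) = 3.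
  by rewrite size_cat size_iota subnKC // -so leq_addr.
have so' : 3 - size (mask_idx (emask s e)) = size (outer s e) by rewrite -so addKn.
have wf : wf_edge (size (s ++ outer s e)) (pattern (emask s e)).
  rewrite /wf_edge sp /=; apply/andP; split.
    rewrite cat_uniq filter_uniq ?iota_uniq // andbT /=.
    apply/hasPn=> i; rewrite mem_iota mem_filter mem_iota /=; lia.
  apply/allP=> i; rewrite mem_cat mem_filter !mem_iota so' size_map size_cat.
  case/orP; lia.
rewrite wf (edgeE _ wf) /pattern map_cat so' size_map.
suff -> : [set x in [seq nth x0 (s ++ outer s e) i | i <- mask_idx (emask s e)] ++
   [seq nth x0 (s ++ outer s e) i | i <- iota (size s) (size (outer s e))]] = e by [].
have -> : [seq nth x0 (s ++ outer s e) i | i <- iota (size s) (size (outer s e))] = outer s e.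
  rewrite -[RHS](mkseq_nth x0) /mkseq -[size s]addn0 iotaDl -map_comp.
  by apply: eq_map => i /=; rewrite nth_cat ltnNge leq_addr /= addKn.
have -> : [seq nth x0 (s ++ outer s e) i | i <- mask_idx (emask s e)] = [seq x <- s | x \in e].
  rewrite -mask_idxE; apply/eq_in_map => i.
  by rewrite mem_filter mem_iota size_map nth_cat /= => /andP[_ ->].
apply/setP=> x; rewrite !inE mem_cat mem_filter mem_enum !inE.
by case: (x \in e); case: (x \in s).
Qed.

Lemma mask_noP s L e : uniq s -> known s L -> e \in H ->
  ~~ has_path (pattern (emask s e) :: L).
Proof.
move=> us kL eH; apply: (@known_path (s ++ outer s e)); first exact: uniq_outer.
by have := known_pattern us eH; rewrite /known /= andbT => -> /=; apply: known_cat.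
Qed.

Lemma size_emask s e : size (emask s e) = size s.
Proof. exact: size_map. Qed.

Lemma emask_le3 s e : uniq s -> e \in H -> count id (emask s e) <= 3.
Proof.
move=> us eH; rewrite -(size_outer us (uH eH)) -(size_map (nth x0 s) (mask_idx _)).
by rewrite mask_idxE count_map size_filter; apply: leq_addr.
Qed.

(** Turns a claim on how an arbitrary edge meets [s] into a finite check: a mask is impossible if it
    has more than three bits or completes a path with the edges [L]. *)
Lemma mask_check (phi : bitseq -> bool) s L e :
  uniq s -> known s L -> e \in H ->
  all (fun m => [|| 3 < count id m, has_path (pattern m :: L) | phi m]) (masks (size s)) ->
  phi (emask s e).
Proof.
move=> us kL eH /allP/(_ (emask s e)); rewrite -{1}(size_emask s e) => /(_ (mem_masks _)).
by rewrite ltnNge emask_le3 //= (negbTE (mask_noP us kL eH)).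
Qed.

(** Induction along the search: the first triple is absent and dropped, or it is present, uses up
    one unit of [k], joins [L], and rules out the triples that would now complete a path. *)
Lemma few_sound fuel k s L ts : uniq s -> known s L -> all (wf_edge (size s)) ts ->
  few fuel k L ts -> #|[set e in H | e \in [seq edge s t | t <- ts]]| <= k.
Proof.
move=> us kL wts.
have small k' ts' : size ts' <= k' ->
    #|[set e in H | e \in [seq edge s t | t <- ts']]| <= k'.
  rewrite -(size_map (edge s) ts') => /(leq_trans _); apply.
  apply: leq_trans (card_size _); apply: subset_leq_card.
  by apply/subsetP=> e; rewrite inE => /andP[].
elim: fuel k L ts kL wts => [|fuel IH] k L ts kL wts /=.
  by case: leqP => // sk _; apply: small.
case: leqP => [sk _|_]; first exact: small.
case: ts wts => [_ _|t ts /= /andP[wt wts]]; first exact: small.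
case f1: (few _ _ _ _) => //.
case: (boolP (edge s t \in H)) => tH; last first.
  move=> _; apply: leq_trans (IH _ _ _ kL wts f1); apply: subset_leq_card.
  apply/subsetP=> e; rewrite !inE => /andP[eH /orP[/eqP et|->]]; last by rewrite eH.
  by rewrite -et eH in tH.
have kL' : known s (t :: L) by rewrite /known /= wt tH.
rewrite (negbTE (known_path us kL')); case: k f1 => // k f1 f2; rewrite -add1n.
have wts' : all (wf_edge (size s)) [seq t' <- ts | ~~ has_path [:: t', t & L]].
  by apply/allP=> u; rewrite mem_filter => /andP[_ /(allP wts)].
apply: leq_trans (leq_add (leqnn 1) (IH _ _ _ kL' wts' f2)).
rewrite -(cards1 (edge s t)); apply: leq_trans (leq_card_setU _ _).
apply: subset_leq_card; apply/subsetP=> e; rewrite !inE => /andP[eH].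
case/orP=> [->//|/mapP[u uts eu]]; rewrite eH; apply/orP; right.
rewrite eu map_f // mem_filter uts andbT; apply: (@known_path s) => //.
by rewrite /known /= -eu eH (allP wts u uts) -/(known s (t :: L)).
Qed.

(** The vertices [r] lie outside the counted set; they serve to name known edges that leave [s]. *)
Lemma few_insideP k s r L : uniq (s ++ r) -> known (s ++ r) L ->
  few_inside (size s) k L -> #|inside H [set x in s]| <= k.
Proof.
move=> us kL fk; have wts : all (wf_edge (size s)) (triples (size s)).
  apply/allP=> t /mapP[m]; rewrite mem_filter => /andP[c3 mm] ->.
  have sm : size m = size s.
    elim: (size s) m mm {c3} => [|n IH] m; first by rewrite inE => /eqP->.
    by case/allpairsP=> -[b m'] [_ /IH /= sm ->] /=; rewrite sm.
  rewrite /wf_edge filter_uniq ?iota_uniq //.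
  have -> : size (mask_idx m) = count id m.
    rewrite size_filter -[RHS](congr1 (count id) (mkseq_nth false m)) /mkseq.
    by rewrite count_map; apply: eq_count.
  rewrite c3 /=; apply/allP=> i; rewrite mem_filter mem_iota sm; lia.
have wts' : all (wf_edge (size (s ++ r)))
    [seq t <- triples (size s) | ~~ has_path (t :: L)].
  apply/allP=> t; rewrite mem_filter => /andP[_ /(allP wts)].
  by apply: wf_edge_le; rewrite size_cat leq_addr.
apply: leq_trans (few_sound us kL wts' fk); apply: subset_leq_card.
apply/subsetP=> e; rewrite !inE => /andP[eH es]; rewrite eH /=.
have us' : uniq s by move: us; rewrite cat_uniq => /and3P[].
have o0 : outer s e = [::].
  have /eqP : e :\: [set x in s] = set0 by apply/eqP; rewrite setD_eq0.
  by rewrite /outer => /eqP->; rewrite enum_set0.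
have := known_pattern us' eH; rewrite o0 /known /= andbT => /andP[wf _].
have := known_pattern us' eH; rewrite o0 /known => k1.
have so := size_outer us' (uH eH); rewrite o0 addn0 in so.
have pE : pattern (emask s e) = mask_idx (emask s e).
  by rewrite /pattern so subnn cats0.
have eE : e = edge (s ++ r) (mask_idx (emask s e)).
  rewrite pE cats0 in wf.
  have w2 : wf_edge (size (s ++ r)) (mask_idx (emask s e)).
    by apply: wf_edge_le wf; rewrite size_cat leq_addr.
  rewrite (edgeE _ w2); apply/setP=> x; rewrite !inE.
  have -> : [seq nth x0 (s ++ r) i | i <- mask_idx (emask s e)] = [seq x <- s | x \in e].
    rewrite -mask_idxE; apply/eq_in_map => i.
    by rewrite mem_filter mem_iota size_map nth_cat /= => /andP[_ ->].
  rewrite mem_filter; case xe: (x \in e) => //=.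
  by have := subsetP es x xe; rewrite inE.
have mt : mask_idx (emask s e) \in triples (size s).
  apply/mapP; exists (emask s e) => //; rewrite mem_filter.
  rewrite -(size_emask s e) mem_masks andbT count_map -size_filter.
  by rewrite -mask_idxE size_map so.
apply/mapP; exists (mask_idx (emask s e)) => //; rewrite mem_filter mt andbT.
apply: (@known_path (s ++ r)) => //; rewrite /known /= -/(known (s ++ r) L) kL andbT -eE eH andbT.
by rewrite pE cats0 in wf; apply: wf_edge_le wf; rewrite size_cat leq_addr.
Qed.

End Labels.
End Graphs.

(** * Numerical bounds *)

(* For 3-uniform path-free graphs without dense 6-sets: [ub k] bounds the number of
   edges on [k] vertices, [gb m] that of the graphs on [m] vertices that contain two
   disjoint edges and do not embed into a comet. *)
Definition ub k := nth 'C(k - 1, 2) [:: 0; 0; 0; 1; 4; 10; 14; 17; 24; 29] k.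
Definition gb m :=
  nth (3 + 'C(m - 4, 2)) [:: 0; 0; 0; 0; 0; 0; 14; 15; 16; 19; 23; 28; 36] m.

Lemma bin2S n : 'C(n.+1, 2) = 'C(n, 2) + n.
Proof. by rewrite binS bin1. Qed.

Lemma bin2D i j : 'C(i + j, 2) = 'C(i, 2) + 'C(j, 2) + i * j.
Proof. by elim: j => [|j IH]; rewrite ?addn0 ?muln0 ?addn0 // addnS !bin2S IH; lia. Qed.

Tactic Notation "small" ident(m) integer(k) :=
  do k (destruct m as [|m]; [by vm_compute|]).
Lemma nth_consS (z x : nat) l i : nth z (x :: l) i.+1 = nth z l i.
Proof. by []. Qed.

Ltac large :=
  rewrite /ub /gb -?addnA ?addSn ?addnS ?add0n ?addn0 ?succnK ?subSS ?subn0;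
  rewrite ?nth_consS ?nth_nil ?bin2S; lia.

(** Here and in the next four inequalities [w] counts the vertices outside the six of a
    configuration [abp], [abc], [cuv]. This is the case where no edge leaves these six: at most 14
    inside by sparseness, [ub w] outside. *)
Lemma gb14 w : 14 + ub w <= gb (w + 6).
Proof. rewrite addnC [w + 6]addnC; small w 10; large. Qed.

(** An edge [abx] leaves the six vertices: 11 edges at most inside, and at most [w] of the form
    [abx]. *)
Lemma gb11_ab w : 0 < w -> 11 + w + ub w <= gb (6 + w).
Proof. small w 10; large. Qed.

(** An edge [cux] or [cvx] leaves: [maxn 3 w] bounds the edges leaving through two of [c], [u], [v],
    and the edges outside avoid [x]. *)
Lemma gb11_cu w : 0 < w -> 11 + w + maxn 3 w + ub w.-1 <= gb (6 + w).
Proof. small w 12; large. Qed.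

Lemma gb8 w : 0 < w -> 8 + w + maxn 3 w + ub w <= gb (6 + w).
Proof. small w 11; large. Qed.

(** An edge [pxy] leaves: six edges inside, ['C(w, 2)] of the form [pxy], and [w - 2] outside, all
    through one pair. *)
Lemma gb6 w : 1 < w <= 4 -> 6 + w + maxn 3 w + 'C(w, 2) + (w - 2) <= gb (6 + w).
Proof. small w 5; large. Qed.

(** Pays for deleting two vertices that lie in the same edges; the summand [12 < m - 2] allows the
    remainder to be a comet. *)
Lemma gb_twin m : 11 <= m -> m - 2 + (gb (m - 2) + (12 < m - 2)) <= gb m.
Proof. small m 15; large. Qed.

Lemma gb_twin6 m : 8 <= m -> m - 6 + (gb (m - 2) + (12 < m - 2)) <= gb m.
Proof. small m 15; large. Qed.

Lemma gb_K4 m : 9 <= m -> 4 + (gb (m - 3) + (12 < m - 3)) <= gb m.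
Proof. small m 16; large. Qed.

(** The left side is ['C(m - 4, 2) - 1], five less than the comet. *)
Lemma gb_star m : 9 <= m -> m - 6 + 'C(m - 5, 2) <= gb m.
Proof. small m 13; large. Qed.

Lemma gb_ub m : 6 <= m -> gb m + (12 < m) <= ub m.
Proof. small m 13; large. Qed.

Lemma gb_comet m : 6 <= m -> 4 + 'C(m - 4, 2) <= gb m + (12 < m).
Proof. small m 13; large. Qed.

Lemma ub_add i j : 3 <= i -> 3 <= j -> ub i + ub j <= gb (i + j).
Proof.
wlog ij : i j / i <= j.
  move=> W i3 j3; case/orP: (leq_total i j) => ij; first exact: W.
  by rewrite addnC [i + j]addnC; apply: W.
move=> i3 j3; case: (ltnP j 10) => j10.
  have : all (fun i => all (fun j => (3 <= i) && (3 <= j) ==> (ub i + ub j <= gb (i + j)))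
           (iota 0 10)) (iota 0 10) by vm_compute.
  move=> /allP/(_ i); rewrite mem_iota => /(_ (leq_ltn_trans ij j10))/allP/(_ j).
  by rewrite mem_iota i3 j3; apply.
have {j3} [k ->] : exists k, j = k + 10 by exists (j - 10); rewrite subnK.
have {}ij : True by [].
case: (ltnP i 10) => i10.
  move: i3 i10; do 10 (destruct i as [|i]; first by [] || by move=> _ _; large).
  by [].
have {i3 i10} [i' ->] : exists i', i = i' + 10 by exists (i - 10); rewrite subnK.
rewrite /ub /gb -?addnA ?addSn ?addnS ?add0n ?addn0 ?subSS ?subn0 ?nth_consS ?nth_nil ?bin2S bin2D ?add0n.
(* The product from [bin2D] is the gain of the joint vertex set over the two parts; only its sign is
   needed. *)
have := leq0n (i' * k); rewrite ?add0n; lia.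
Qed.


Lemma ub_nonstar k : 8 <= k -> maxn 24 (5 * k - 16) <= ub k.
Proof.
small k 12; move=> _; have -> : maxn 24 (5 * k.+4.+4.+4 - 16) = 5 * k + 44 by lia.
large.
Qed.

Lemma ub_star k : 8 <= k -> 'C(k - 1, 2) <= ub k.
Proof. small k 12; large. Qed.

Ltac card_lia :=
  repeat match goal with
  | h : is_true (leq _ _) |- _ => revert h
  | h : @eq nat _ _ |- _ => revert h
  end;
  repeat match goal with
  | |- context [ @card.body ?I ?A ] => let n := fresh "n" in move: (@card.body I A) => n
  end; clear; lia.

(** * Counting and intersecting families *)

Section Count.
Variable T : finType.
Implicit Types (H : {set {set T}}) (e f g S V W X : {set T}) (s : seq T).

Definition on H V := forall e, e \in H -> e \subset V.
Definition intersecting H := forall e f, e \in H -> f \in H -> ~~ [disjoint e & f].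

Lemma cardU_le (I : finType) (A B : {set I}) : #|A :|: B| <= #|A| + #|B|.
Proof. exact: leq_card_setU. Qed.

Lemma third e y z : #|e| = 3 -> y \in e -> z \in e -> y != z ->
  exists x, [/\ x != y, x != z & e = [set y; z; x]].
Proof.
move=> e3 ye ze yz.
have /cards1P[x ex] : #|e :\ y :\ z| == 1.
  have := cardsD1 y e; have := cardsD1 z (e :\ y).
  by rewrite !inE eq_sym yz ze ye e3 /= => -> /eqP; rewrite !eqSS eq_sym.
have : x \in e :\ y :\ z by rewrite ex set11.
rewrite !inE => /and3P[xz xy xe]; exists x; split=> //.
apply/setP=> t; rewrite !inE; have := ex => /setP/(_ t); rewrite !inE.
case: (t =P y) => [-> _|_]; first by rewrite ye.
case: (t =P z) => [-> _|_] /=; first by rewrite ze.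
by move=> ->.
Qed.

Lemma others e y : #|e| = 3 -> y \in e ->
  exists p q, [/\ p != y, q != y, p != q & e = [set y; p; q]].
Proof.
move=> e3 ye; have /card_gt0P[p] : 0 < #|e :\ y|.
  by have := cardsD1 y e; rewrite ye e3; lia.
rewrite !inE => /andP[py pe]; have yp : y != p by rewrite eq_sym.
by have [q [qy qp ->]] := third e3 ye pe yp; exists p, q; rewrite [p == q]eq_sym.
Qed.

Lemma card_triples H V : uni3 H -> on H V -> #|H| <= 'C(#|V|, 3).
Proof.
move=> uH oH; rewrite -cards_draws; apply: subset_leq_card; apply/subsetP=> e eH.
by rewrite inE oH //= uH.
Qed.

Lemma card_pair H y z W : uni3 H -> y != z ->
  (forall e, e \in H -> [/\ y \in e, z \in e & e :\ y :\ z \subset W]) -> #|H| <= #|W|.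
Proof.
move=> uH yz hH; apply: leq_trans (leq_imset_card (fun x => [set y; z; x]) W).
apply: subset_leq_card; apply/subsetP=> e eH; have [ye ze eW] := hH e eH.
have [x [xy xz ex]] := third (uH e eH) ye ze yz.
apply/imsetP; exists x => //; apply: (subsetP eW).
by rewrite ex !inE xy xz eqxx orbT.
Qed.

Lemma card_link H c W : uni3 H ->
  (forall e, e \in H -> c \in e /\ e :\ c \subset W) -> #|H| <= 'C(#|W|, 2).
Proof.
move=> uH hH; rewrite -cards_draws.
have <- : #|[set e :\ c | e in H]| = #|H|.
  apply: card_in_imset => e f eH fH ef; have [ce _] := hH e eH.
  by have [cf _] := hH f fH; rewrite -(setD1K ce) ef setD1K.
apply: subset_leq_card; apply/subsetP=> _ /imsetP[e eH ->].
have [ce eW] := hH e eH; rewrite inE eW /=.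
by have := cardsD1 c e; rewrite ce (uH e eH) => /eqP; rewrite eqSS eq_sym.
Qed.

Section Intersecting.
Variables (H : {set {set T}}) (V : {set T}).
Hypotheses (uH : uni3 H) (oH : on H V) (iH : intersecting H).

(** Complementation in [S] sends edges to non-edges, so at most half of the 20 triples are
    present. *)
Lemma intersecting6 S : #|S| = 6 -> #|inside H S| <= 10.
Proof.
move=> S6; set K := inside H S; set K' := [set S :\: e | e in K].
have sub e : e \in K -> e \subset S by rewrite inE => /andP[].
have KH e : e \in K -> e \in H by rewrite inE => /andP[].
have cK' : #|K'| = #|K|.
  have inv e : e \subset S -> S :\: (S :\: e) = e.
    by move=> eS; rewrite setDDr setDv set0U (setIidPr eS).
  by rewrite card_in_imset // => e f /sub/inv eS /sub/inv fS ef; rewrite -eS ef.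
have dK : [disjoint K & K'].
  apply/pred0P=> f /=; apply/negP=> /andP[fK /imsetP[e eK fe]].
  have := iH (KH e eK) (KH f fK); rewrite fe -setI_eq0 => /negP[].
  by apply/eqP/setP=> t; rewrite !inE; case: (t \in e).
have : #|K :|: K'| <= 'C(6, 3).
  rewrite -S6 -cards_draws; apply: subset_leq_card; apply/subsetP=> e.
  rewrite !inE => /orP[/andP[eH ->]|/imsetP[f fK ->]]; first by rewrite uH.
  rewrite subsetDl /= cardsD (setIidPr (sub f fK)) S6 (uH (KH f fK)) //.
rewrite cardsU disjoint_setI0 // cards0 subn0 cK' (_ : 'C(6, 3) = 20) //; lia.
Qed.

(** Averaging over the seven sets [V :\ v]: each edge lies in four of them, so [4 * #|H| <= 70]. *)
Lemma intersecting7 : #|V| = 7 -> #|H| <= 17.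
Proof.
move=> V7.
have : \sum_(v in V) #|inside H (V :\ v)| <= \sum_(v in V) 10.
  apply: leq_sum => v vV; apply: intersecting6.
  by have := cardsD1 v V; rewrite vV V7 => -[].
rewrite sum_nat_const V7.
under eq_bigr do rewrite -sum1_card.
rewrite (exchange_big_dep (mem H)) /=; last by move=> v e _; rewrite inE => /andP[].
under eq_bigr => e eH.
  rewrite sum1_card.
  rewrite (_ : #|_| = 4); last first.
    rewrite (_ : #|_| = #|V :\: e|).
      by rewrite cardsD (setIidPr (oH eH)) V7 uH.
    apply: eq_card => v; rewrite !inE unfold_in /= inE eH subsetD1 oH //= andbC.
    by [].
  over.
rewrite sum_nat_const; move: #|H| => h; lia.
Qed.

Definition star x := [set e in H | x \in e].
Definition star2 x y := [set e in H | (x \in e) && (y \in e)].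

Lemma uni3_sub (K : {set {set T}}) : K \subset H -> uni3 K.
Proof. by move=> /subsetP KH e /KH /uH. Qed.

(** The edge [g] misses [x], so it is [{y,p,q}], and an edge through [x] but not [y] meets it in [p]
    or [q]: at most [#|V| - 3] edges contain [p], and at most [#|V| - 4] contain [q] but not [p]. *)
Lemma heavy_side x y : x != y -> (forall e, e \in H -> (x \in e) || (y \in e)) ->
  (exists2 g, g \in H & x \notin g) -> #|[set e in H | (x \in e) && (y \notin e)]| <= 2 * #|V| - 7.
Proof.
move=> xy cov [g gH xg].
have yg : y \in g by have := cov g gH; rewrite (negbTE xg).
have [p [q [py qy pq gE]]] := others (uH gH) yg.
have gV := subsetP (oH gH).
have xp : x != p by apply: contraNneq xg => ->; rewrite gE !inE eqxx orbT.
have xq : x != q by apply: contraNneq xg => ->; rewrite gE !inE eqxx orbT.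
have [pV qV yV] : [/\ p \in V, q \in V & y \in V].
  by split; apply: gV; rewrite gE !inE eqxx ?orbT.
set K := [set e in H | _].
case: (set_0Vmem K) => [->|[e0]]; first by rewrite cards0.
rewrite inE => /and3P[e0H xe0 _]; have xV := subsetP (oH e0H) x xe0.
have cV : #|V :\ x :\ y :\ p :\ q|.+4 = #|V|.
  rewrite (cardsD1 x V) xV (cardsD1 y (V :\ x)) !inE yV eq_sym xy.
  rewrite (cardsD1 p (V :\ x :\ y)) !inE pV py eq_sym xp.
  by rewrite (cardsD1 q (V :\ x :\ y :\ p)) !inE qV qy eq_sym pq eq_sym xq.
have cV' : #|V :\ x :\ y :\ p|.+3 = #|V|.
  rewrite (cardsD1 x V) xV (cardsD1 y (V :\ x)) !inE yV eq_sym xy.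
  by rewrite (cardsD1 p (V :\ x :\ y)) !inE pV py eq_sym xp.
have K1 : #|K :&: star2 x p| <= #|V :\ x :\ y :\ p|.
  apply: (@card_pair _ x p) => //.
    by apply: uni3_sub; apply/subsetP=> e; rewrite !inE => /andP[/and3P[]].
  move=> e; rewrite !inE => /andP[/and3P[eH xe ye] /and3P[_ _ pe]]; split=> //.
  apply/subsetP=> t; rewrite !inE => /and3P[-> -> te].
  by rewrite (subsetP (oH eH)) //= ?andbT; apply: contraNneq ye => <-.
have K2 : #|K :\: star2 x p| <= #|V :\ x :\ y :\ p :\ q|.
  apply: (@card_pair _ x q) => //.
    by apply: uni3_sub; apply/subsetP=> e; rewrite !inE => /andP[_ /and3P[]].
  move=> e; rewrite !inE => /andP[pe' /and3P[eH xe ye]].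
  have pe : p \notin e by move: pe'; rewrite eH xe.
  have qe : q \in e.
    have := iH eH gH; apply: contraR => qe; apply/pred0P=> t /=; apply/negP=> /andP[te].
    by rewrite gE !inE => /orP[/orP[]|] /eqP tE; rewrite -tE te in ye pe qe.
  split=> //; apply/subsetP=> t; rewrite !inE => /and3P[-> -> te].
  rewrite (subsetP (oH eH)) //= ?andbT; apply/andP; split.
    by apply: contraNneq pe => <-.
  by apply: contraNneq ye => <-.
have := cardsID (star2 x p) K.
card_lia.
Qed.

(** With [k] the number of vertices, a pair in at least four edges gives
    [(k - 2) + 2 * (2 * k - 7) = 5 * k - 16]; otherwise all pairs lie in at most three edges, and
    the count stays at 24. *)
Lemma nonstar_bound : 8 <= #|V| -> (forall x, exists2 e, e \in H & x \notin e) ->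
  #|H| <= maxn 24 (5 * #|V| - 16).
Proof.
move=> V8 ns.
(* An edge missing both [x] and [y] would have to contain the third vertices of all
   edges through [x] and [y]; so four such edges make [{x,y}] a cover. *)
case: (boolP [exists x, exists y, (x != y) && (3 < #|star2 x y|)]).
  case/existsP=> x /existsP[y /andP[xy heavy]].
  have cov e : e \in H -> (x \in e) || (y \in e).
    move=> eH; apply: contraLR heavy; rewrite negb_or -leqNgt => /andP[xe ye].
    rewrite -(uH eH); apply: (@card_pair _ x y) => //.
      by apply: uni3_sub; apply/subsetP=> f; rewrite !inE => /andP[].
    move=> f; rewrite !inE => /and3P[fH xf yf]; split=> //.
    have [t [_ _ fE]] := third (uH fH) xf yf xy.
    have te : t \in e.
      have := iH eH fH; apply: contraR => te; apply/pred0P=> s /=; apply/negP=> /andP[se].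
      by rewrite fE !inE => /orP[/orP[]|] /eqP sE; rewrite -sE se in xe ye te.
    apply/subsetP=> s; rewrite fE !inE => /and3P[/negbTE-> /negbTE->] /=.
    by move=> /eqP->.
  have := heavy_side xy cov (ns x).
  have cov' e : e \in H -> (y \in e) || (x \in e) by rewrite orbC; apply: cov.
  have yx : y != x by rewrite eq_sym.
  have := heavy_side yx cov' (ns y).
  set Ky := [set _ in _ | _]; set Kx := [set _ in _ | _] => cy cx.
  have c2 : #|star2 x y| <= #|V| - 2.
    have [e] : exists e, e \in star2 x y by apply/card_gt0P; apply: leq_trans heavy.
    rewrite !inE => /and3P[eH xe ye].
    have -> : #|V| - 2 = #|V :\ x :\ y|.
      rewrite (cardsD1 x V) (subsetP (oH eH) x xe) (cardsD1 y (V :\ x)) !inE.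
      by rewrite (subsetP (oH eH) y ye) yx /= !addSn subSS subSS subn0.
    apply: (@card_pair _ x y) => //.
      by apply: uni3_sub; apply/subsetP=> f; rewrite !inE => /andP[].
    move=> f; rewrite !inE => /and3P[fH -> ->]; split=> //.
    by apply: setSD; apply: setSD; apply: oH.
  have HE : H \subset star2 x y :|: (Kx :|: Ky).
    apply/subsetP=> e eH; rewrite !inE eH; have := cov e eH.
    by case: (x \in e); case: (y \in e).
  have := subset_leq_card HE.
  have := cardU_le (star2 x y) (Kx :|: Ky); have := cardU_le Kx Ky; card_lia.
rewrite negb_exists => /forallP light.
have {}light x y : x != y -> #|star2 x y| <= 3.
  move=> xy; have := light x; rewrite negb_exists => /forallP/(_ y).
  by rewrite xy -leqNgt.
(* Some edge [g] misses [x], and every edge at [x] meets it, so three pairs cover the star of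
   [x]. *)
have deg d x : (forall y, x != y -> #|star2 x y| <= d) -> #|star x| <= 3 * d.
  move=> cd; have [g gH xg] := ns x.
  have /card_gt0P[p pg] : 0 < #|g| by rewrite uH.
  have [q [r [qp rp qr gE]]] := others (uH gH) pg.
  have xn t : t \in g -> x != t by apply: contraTneq => <-.
  have xp := xn p pg; have xq : x != q by apply: xn; rewrite gE !inE eqxx orbT.
  have xr : x != r by apply: xn; rewrite gE !inE eqxx orbT.
  have sE : star x \subset star2 x p :|: (star2 x q :|: star2 x r).
    apply/subsetP=> e; rewrite !inE => /andP[eH xe]; rewrite eH xe /=.
    have := iH eH gH; apply: contraR; rewrite !negb_or => /and3P[pe qe re].
    apply/pred0P=> s /=; apply/negP=> /andP[se].
    by rewrite gE !inE => /orP[/orP[]|] /eqP sE; rewrite -sE se in pe qe re.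
  have := subset_leq_card sE; have := cardU_le (star2 x q) (star2 x r).
  have := cardU_le (star2 x p) (star2 x q :|: star2 x r).
  have := cd p xp; have := cd q xq; have := cd r xr; card_lia.
have cover3 e x y z : e \in H -> e = [set x; y; z] ->
    H \subset (star x :|: star y) :|: (star z :\: star x).
  move=> eH eE; apply/subsetP=> f fH; rewrite !inE fH /=.
  case xf: (x \in f) => //=; case yf: (y \in f) => //=.
  have := iH fH eH; apply: contraR => zf; apply/pred0P=> s /=; apply/negP=> /andP[sf].
  by rewrite eE !inE => /orP[/orP[]|] /eqP sE; move: xf yf zf; rewrite -sE sf.
(* All degrees are at most 9. If [x], [y] share two edges and [xyz] is one of them, the edges number
   at most [(9 + 9 - 2) + (9 - 1) = 24]. If all pairs lie in at most one edge, degrees drop to 3. *)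
case: (boolP [exists x, exists y, (x != y) && (1 < #|star2 x y|)]).
  case/existsP=> x /existsP[y /andP[xy heavy]].
  have [e] : exists e, e \in star2 x y by apply/card_gt0P; apply: ltnW.
  rewrite inE => /and3P[eH xe ye]; have [z [zx zy eE]] := third (uH eH) xe ye xy.
  have := subset_leq_card (cover3 _ _ _ _ eH eE).
  have := cardU_le (star x :|: star y) (star z :\: star x).
  have := cardsUI (star x) (star y); have := cardsID (star x) (star z).
  have c1 : 0 < #|star z :&: star x|.
    by apply/card_gt0P; exists e; rewrite !inE eH eE !inE !eqxx ?orbT.
  have c2 : 1 < #|star x :&: star y|.
    apply: leq_trans heavy _; apply: subset_leq_card; apply/subsetP=> f.
    by rewrite !inE => /and3P[-> -> ->].
  have := deg 3 x (light x); have := deg 3 y (light y); have := deg 3 z (light z).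
  card_lia.
rewrite negb_exists => /forallP light1.
have {}light1 x y : x != y -> #|star2 x y| <= 1.
  move=> xy; have := light1 x; rewrite negb_exists => /forallP/(_ y).
  by rewrite xy -leqNgt.
case: (set_0Vmem H) => [->|[e eH]]; first by rewrite cards0.
have /card_gt0P[x xe] : 0 < #|e| by rewrite uH.
have [y [z [_ _ _ eE]]] := others (uH eH) xe.
have := subset_leq_card (cover3 _ _ _ _ eH eE).
have := cardU_le (star x :|: star y) (star z :\: star x).
have := cardU_le (star x) (star y); have := subset_leq_card (subsetDl (star z) (star x)).
have := deg 1 x (light1 x); have := deg 1 y (light1 y); have := deg 1 z (light1 z).
card_lia.
Qed.

Lemma intersecting_bound : 7 <= #|V| -> #|H| <= ub #|V|.
Proof.
move=> V7; case: (ltngtP #|V| 7) V7 => // [V8 _|V7 _]; last by rewrite V7 intersecting7.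
case: (boolP [forall x, exists e, (e \in H) && (x \notin e)]).
  move=> /forallP ns; apply: leq_trans (nonstar_bound V8 _) _.
    by move=> x; have /existsP[e /andP[eH xe]] := ns x; exists e.
  exact: ub_nonstar.
rewrite negb_forall => /existsP[c]; rewrite negb_exists => /forallP st.
have cst e : e \in H -> c \in e.
  by move=> eH; have := st e; rewrite eH negbK.
case: (set_0Vmem H) => [->|[e0 e0H]]; first by rewrite cards0.
have cV := subsetP (oH e0H) c (cst _ e0H).
have : #|H| <= 'C(#|V :\ c|, 2).
  apply: (@card_link _ c) => // e eH; split; first exact: cst.
  by apply: setSD; apply: oH.
have -> : #|V :\ c| = #|V| - 1 by rewrite (cardsD1 c V) cV addKn.
by move=> /leq_trans; apply; apply: ub_star.
Qed.

End Intersecting.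
End Count.

(** * Graphs without dense 6-sets *)

Section Main.
Variable T : finType.
Implicit Types (H : {set {set T}}) (e f g S V W X : {set T}) (s : seq T).

Definition sparse6 H := forall S, #|S| = 6 -> #|inside H S| <= 14.
Definition good H := [/\ uni3 H, path_free H & sparse6 H].
Definition has_match H := exists e f, [/\ e \in H, f \in H & [disjoint e & f]].
Definition in_comet V H := exists c (A : {set T}), [/\ c \in V, A \subset V, c \notin A, #|A| = 3 &
  forall e, e \in H -> (e \subset c |: A) || (c \in e) && [disjoint e & A]].

Lemma inside_sub H S : inside H S \subset H.
Proof. by apply/subsetP=> e; rewrite inE => /andP[]. Qed.

Lemma on_inside H S : on (inside H S) S.
Proof. by move=> e; rewrite inE => /andP[]. Qed.

Lemma good_sub (H K : {set {set T}}) : K \subset H -> good H -> good K.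
Proof.
move=> /subsetP KH [uH pH sH]; split=> [e /KH /uH //|e f g /KH eH /KH fH /KH gH|S S6].
  exact: pH.
apply: leq_trans (sH S S6); apply: subset_leq_card; apply/subsetP=> e.
by rewrite !inE => /andP[/KH -> ->].
Qed.

Lemma no_matchP H : ~ has_match H -> intersecting H.
Proof. by move=> nM e f eH fH; apply/negP=> d; apply: nM; exists e, f. Qed.

Lemma has_matchP H : has_match H \/ ~ has_match H.
Proof.
case: (boolP [exists e in H, exists f in H, [disjoint e & f]]).
  by case/exists_inP=> e eH /exists_inP[f fH d]; left; exists e, f.
move=> n; right=> -[e [f [eH fH d]]]; case/negP: n.
by apply/exists_inP; exists e => //; apply/exists_inP; exists f.
Qed.

Lemma cardD_sub V X : X \subset V -> #|V :\: X| = #|V| - #|X|.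
Proof. by move=> XV; rewrite cardsD (setIidPr XV). Qed.

Lemma card_seq s : uniq s -> #|[set x in s]| = size s.
Proof. by move=> us; rewrite cardsE; apply/card_uniqP. Qed.

Lemma match_card H V : uni3 H -> on H V -> has_match H -> 6 <= #|V|.
Proof.
move=> uH oH [e [f [eH fH d]]]; rewrite (_ : 6 = #|e :|: f|); last first.
  by rewrite cardsU disjoint_setI0 // cards0 !uH.
by apply: subset_leq_card; rewrite subUset !oH.
Qed.

Lemma comet_card V H : uni3 H -> on H V -> in_comet V H -> #|H| <= 4 + 'C(#|V| - 4, 2).
Proof.
move=> uH oH [c [A [cV AV cA A3 hH]]].
set K := [set e in H | (c \in e) && [disjoint e & A]].
have HE : H \subset inside H (c |: A) :|: K.
  by apply/subsetP=> e eH; rewrite !inE eH; apply: hH.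
have := subset_leq_card HE.
have cs : #|c |: A| = 4 by rewrite cardsU1 cA A3.
have sV : c |: A \subset V by rewrite subUset sub1set cV.
have : #|K| <= 'C(#|V :\: (c |: A)|, 2).
  apply: (@card_link _ _ c) => [e|e]; rewrite inE => /and3P[eH ce eA]; first exact: uH.
  split=> //; apply/subsetP=> t; rewrite !inE negb_or => /andP[-> te].
  by rewrite (subsetP (oH e eH)) // (disjointFr eA).
have : #|inside H (c |: A)| <= 'C(#|c |: A|, 3).
  by apply: card_triples; [move=> e; rewrite inE => /andP[/uH] | apply: on_inside].
rewrite cs cardD_sub // cs (_ : 'C(4, 3) = 4) //.
have := cardU_le (inside H (c |: A)) K; card_lia.
Qed.

Lemma count3_sub H s e : uni3 H -> uniq s -> e \in H -> count id (emask s e) = 3 ->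
  e \subset [set x in s].
Proof.
move=> uH us eH c3; rewrite -setD_eq0 -cards_eq0 cardE -/(outer s e).
have /card_gt0P[x0 _] : 0 < #|e| by rewrite uH.
have := size_outer x0 us (uH e eH); have : size (mask_idx (emask s e)) = 3.
  rewrite -c3 count_map -size_filter -(size_map (nth x0 s)) mask_idxE //.
lia.
Qed.

(** The induction hypothesis. The extra edge beyond 12 vertices lets it hold for comets too. *)
Definition bounded_below n := forall V H, #|V| < n -> good H -> on H V ->
  has_match H -> #|H| <= gb #|V| + (12 < #|V|).

Section Step.
Variables (H : {set {set T}}) (V : {set T}).
Hypotheses (gH : good H) (oH : on H V).
Hypothesis IH : bounded_below #|V|.

Let uH : uni3 H. Proof. by case: gH. Qed.
Let pH : path_free H. Proof. by case: gH. Qed.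

Lemma good_inside S : good (inside H S).
Proof. exact: good_sub (inside_sub _ _) gH. Qed.

(** Without two disjoint edges the hypothesis is void; then the part is an intersecting family, or
    it has at most six vertices and is bounded by sparseness or by its number of triples. *)
Lemma IH_ub n S : bounded_below n -> #|S| < n -> #|inside H S| <= ub #|S|.
Proof.
move=> IHn SV; have gS := good_inside S; have oS := @on_inside H S.
have uS : uni3 (inside H S) by case: gS.
case: (has_matchP (inside H S)) => [M|/no_matchP iS].
  apply: leq_trans (IHn _ _ SV gS oS M) _; apply: gb_ub; exact: match_card M.
case: (ltnP 6 #|S|) => S7; first exact: intersecting_bound.
case: (ltngtP #|S| 6) S7 => // [S5 _|S6 _]; last first.
  by rewrite S6; have [_ _] := gH; apply.
apply: leq_trans (card_triples uS oS) _.
by case: #|S| S5 => [|[|[|[|[|[]]]]]].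
Qed.

(** If [g] is disjoint from [e], an edge meeting [e] cannot also meet [g]. So the union [X] of the
    edges meeting [e] is separated from all other edges. *)
Lemma disconnected_bound :
  has_match H ->
  (forall e f g, e \in H -> f \in H -> g \in H -> [disjoint e & f] ->
    [disjoint g & e] || [disjoint g & f]) -> #|H| <= gb #|V|.
Proof.
move=> [e [f [eH fH ef]]] nT.
set K := [set g in H | ~~ [disjoint g & e]]; set X := \bigcup_(g in K) g.
have XV : X \subset V by apply/bigcupsP=> g; rewrite inE => /andP[/oH].
have eX : e \subset X.
  have eK : e \in K.
    by rewrite inE eH -setI_eq0 setIid -cards_eq0 uH.
  exact: (bigcup_sup e).
have far g : g \in H -> [disjoint g & e] -> [disjoint g & X].
  move=> gH' ge; rewrite /X; apply/bigcup_disjointP=> k; rewrite inE => /andP[kH ke].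
  have eg : [disjoint e & g] by rewrite disjoint_sym.
  have := nT e g k eH gH' kH eg; rewrite (negbTE ke) /=.
  by rewrite disjoint_sym.
have HE : H \subset inside H X :|: inside H (V :\: X).
  apply/subsetP=> g gH'; rewrite !inE gH' /=; case: (boolP [disjoint g & e]) => ge.
    by rewrite subsetD oH // far // orbT.
  by rewrite (bigcup_sup g) // inE gH'.
have fX : f \subset V :\: X by rewrite subsetD oH // far // disjoint_sym.
have X3 : 3 <= #|X| by rewrite -(uH eH) subset_leq_card.
have X3' : 3 <= #|V :\: X| by rewrite -(uH fH) subset_leq_card.
have cX := cardsID X V; rewrite (setIidPr XV) in cX.
apply: leq_trans (subset_leq_card HE) _; apply: leq_trans (cardU_le _ _) _.
rewrite -cX; apply: leq_trans (ub_add X3 X3').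
apply: leq_add; apply: (IH_ub IH); lia.
Qed.

End Step.
End Main.

(** * Configurations formed by two disjoint edges and an edge meeting both *)

Section Configurations.
Variable T : finType.
Implicit Types (H : {set {set T}}) (e f g S V W X : {set T}) (s : seq T).

(** [conf2] is a piece of a comet with centre [c] and hub [{a,b,p}]; [conf] lacks its second edge at
    [c] off the hub. *)
Definition conf H a b p c u v := [/\ uniq [:: a; b; p; c; u; v],
  [set a; b; p] \in H, [set a; b; c] \in H & [set c; u; v] \in H].

Definition conf2 H a b p c u v x y := [/\ uniq [:: a; b; p; c; u; v; x; y],
  [set a; b; p] \in H, [set a; b; c] \in H, [set c; u; v] \in H & [set c; x; y] \in H].

Lemma conf_exists H e f g : uni3 H -> path_free H ->
  e \in H -> f \in H -> g \in H -> [disjoint e & f] ->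
  ~~ [disjoint g & e] -> ~~ [disjoint g & f] -> exists a b p c u v, conf H a b p c u v.
Proof.
move=> uH pH.
(* [g] meets one of the two edges in two vertices: otherwise [e], [g], [f] is a path. *)
have aux e' f' g' : e' \in H -> f' \in H -> g' \in H -> [disjoint e' & f'] ->
  #|g' :&: e'| = 2 -> #|g' :&: f'| = 1 -> exists a b p c u v, conf H a b p c u v.
  move=> eH fH gH' ef /eqP/cards2P[a [b [ab ge]]] /eqP/cards1P[c gf].
  have : a \in g' :&: e' by rewrite ge !inE eqxx.
  rewrite inE => /andP[ag ae].
  have : b \in g' :&: e' by rewrite ge !inE eqxx orbT.
  rewrite inE => /andP[bg be].
  have : c \in g' :&: f' by rewrite gf set11.
  rewrite inE => /andP[cg cf].
  have [p [pa pb eE]] := third (uH _ eH) ae be ab.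
  have [c' [ca cb gE]] := third (uH _ gH') ag bg ab.
  have [u [v [uc vc uv fE]]] := others (uH _ fH) cf.
  have pe : p \in e' by rewrite eE !inE eqxx orbT.
  have uf : u \in f' by rewrite fE !inE eqxx orbT.
  have vf : v \in f' by rewrite fE !inE eqxx orbT.
  have ne x y : x \in e' -> y \in f' -> (x == y) = false.
    by move=> xe yf; apply: contraTF xe => /eqP ->; rewrite (disjointFl ef).
  have cc : c = c'.
    by move: cg; rewrite gE !inE ![c == _]eq_sym (ne a c) // (ne b c) //= => /eqP->.
  exists a, b, p, c, u, v; split; rewrite -?eE -?fE ?cc -?gE //.
  rewrite -cc /= !inE (ne a c) ?(ne a u) ?(ne a v) ?(ne b c) ?(ne b u) ?(ne b v) //.
  rewrite (ne p c) ?(ne p u) ?(ne p v) // !negb_or ab [a == p]eq_sym pa.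
  by rewrite [b == p]eq_sym pb [c == u]eq_sym uc [c == v]eq_sym vc uv.
move=> eH fH gH' ef ge gf.
have fe : [disjoint f & e] by rewrite disjoint_sym.
have : #|g :&: e| + #|g :&: f| <= 3.
  rewrite -(uH _ gH') -cardsUI -setIUr -setIIr (disjoint_setI0 ef) setI0 cards0 addn0.
  by apply: subset_leq_card; apply: subsetIl.
move: ge gf; rewrite -!setI_eq0 -!cards_eq0 -!lt0n.
case c1: #|_ :&: e| => [|[|[|n]]] // _; case c2: #|_ :&: f| => [|[|[|m]]] // _ s3;
  rewrite ?addnS // in s3.
- have := pH _ _ _ eH gH' fH; rewrite setIC c1 c2 => /(_ erefl erefl) [].
  by rewrite disjoint_setI0 ?cards0.
- exact: (aux f e g).
- exact: (aux e f g).
Qed.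

(** * Two edges meeting only in the centre *)

Section Double.
Variables (H : {set {set T}}) (V : {set T}).
Hypotheses (gH : good H) (oH : on H V) (IH : bounded_below T #|V|).
Variables a b p c u v x y : T.
Hypothesis cf : conf2 H a b p c u v x y.

Let uH : uni3 H. Proof. by case: gH. Qed.
Let pH : path_free H. Proof. by case: gH. Qed.
Let s := [:: a; b; p; c; u; v; x; y].
Let L := [:: [:: 0; 1; 2]; [:: 0; 1; 3]; [:: 3; 4; 5]; [:: 3; 6; 7]].
Let us : uniq s. Proof. by case: cf. Qed.
Let kL : known a H s L.
Proof. by case: cf => _ h1 h2 h3 h4; rewrite /known /edge /= h1 h2 h3 h4. Qed.

Let sV : [set t in s] \subset V.
Proof.
have [_ /oH h1 /oH h2 /oH h3 /oH h4] := cf.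
move: h1 h2 h3 h4; rewrite !subUset !sub1set.
move=> /andP[/andP[aV bV] pV] /andP[_ cV] /andP[/andP[_ uV] vV] /andP[/andP[_ xV] yV].
apply/subsetP=> t; rewrite !inE.
do 7 (case/orP=> [/eqP->//|]); by move=> /eqP->.
Qed.

Lemma double_ab e : e \in H -> (a \in e) || (b \in e) ->
  (e \subset [set a; b; p; c]) ||
  [&& a \in e, b \in e, u \notin e, v \notin e, x \notin e & y \notin e].
Proof.
move=> eH ab.
pose phi m := let w := nth false m in w 0 || w 1 ==> (w 0 + w 1 + w 2 + w 3 == 3) ||
   [&& w 0, w 1, ~~ w 4, ~~ w 5, ~~ w 6 & ~~ w 7].
have /implyP : phi (emask s e) by apply: (mask_check uH pH us kL eH); vm_compute.
rewrite /= => /(_ ab)/orP[|->]; last by rewrite orbT.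
move=> c3; apply/orP; left.
have us4 : uniq [:: a; b; p; c].
  by move: us; rewrite -(cat_take_drop 4 s) cat_uniq => /and3P[].
have := @count3_sub T H [:: a; b; p; c] e uH us4 eH; rewrite /= addn0 !addnA => /(_ (eqP c3)).
by move/subset_trans; apply; apply/subsetP=> t; rewrite !inE !orbA.
Qed.

(** One of [cuv], [cxy] meets [e] in a single vertex of its outer pair; were [c] not in [e], it
    would link [e] to [abc]. *)
Lemma double_uvxy e : e \in H -> a \notin e -> b \notin e ->
  (u \in e) || (v \in e) -> (x \in e) || (y \in e) -> c \in e.
Proof.
move=> eH /negbTE ae /negbTE be uv xy.
pose phi m := let w := nth false m in
  [&& ~~ w 0, ~~ w 1, w 4 || w 5 & w 6 || w 7] ==> w 3.
have : phi (emask s e) by apply: (mask_check uH pH us kL eH); vm_compute.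
by rewrite /phi /= ae be uv xy.
Qed.

(** If [e] contained [c], then [cuv] or [cxy] would meet it only in [c] and continue [abp], [e] to a
    path. *)
Lemma double_pc e : e \in H -> a \notin e -> b \notin e -> p \in e -> c \notin e.
Proof.
move=> eH /negbTE ae /negbTE be pe.
pose phi m := let w := nth false m in [&& ~~ w 0, ~~ w 1 & w 2] ==> ~~ w 3.
have : phi (emask s e) by apply: (mask_check uH pH us kL eH); vm_compute.
by rewrite /phi /= ae be pe.
Qed.

(** Thus only [apc] and [bpc] can separate [a] from [b], and [double_K4] shows what either of them
    entails. *)
Lemma double_cross e : e \in H -> (a \in e) (+) (b \in e) -> (p \in e) && (c \in e).
Proof.
move=> eH ab.
pose phi m := let w := nth false m in (w 0 (+) w 1) ==> w 2 && w 3.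
have : phi (emask s e) by apply: (mask_check uH pH us kL eH); vm_compute.
by rewrite /phi /= ab.
Qed.

(** A third triple on [{a,b,p,c}] closes this set up at [a], [b] and [p], so that only [c] connects
    it to the rest. *)
Lemma double_K4 t e : t \in [:: a; b] -> [set t; p; c] \in H ->
  e \in H -> [|| a \in e, b \in e | p \in e] -> e \subset [set a; b; p; c].
Proof.
move=> tab tH eH abp.
pose phi m := let w := nth false m in [|| w 0, w 1 | w 2] ==> (w 0 + w 1 + w 2 + w 3 == 3).
have c3 : phi (emask s e).
  move: tab tH; rewrite !inE => /orP[] /eqP-> tH.
    have kL' : known a H s ([:: 0; 2; 3] :: L).
      by rewrite known_cons kL /edge /= tH.
    by apply: (mask_check uH pH us kL' eH); vm_compute.
  have kL' : known a H s ([:: 1; 2; 3] :: L).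
    by rewrite known_cons kL /edge /= tH.
  by apply: (mask_check uH pH us kL' eH); vm_compute.
have us4 : uniq [:: a; b; p; c].
  by move: us; rewrite -(cat_take_drop 4 s) cat_uniq => /and3P[].
move: c3; rewrite /phi /= abp /= => c3.
have := @count3_sub T H [:: a; b; p; c] e uH us4 eH; rewrite /= addn0 !addnA => /(_ (eqP c3)).
by move/subset_trans; apply; apply/subsetP=> t'; rewrite !inE !orbA.
Qed.

(** As in [double_pc] with [z] for [p]: one of [cuv], [cxy] would meet [e] only in [c] and continue
    [abz], [e] to a path. *)
Lemma double_page e z : e \in H -> z \notin s -> [set a; b; z] \in H ->
  a \notin e -> b \notin e -> c \in e -> z \notin e.
Proof.
move=> eH zs zH /negbTE ae /negbTE be ce.
pose phi m := let w := nth false m in [&& ~~ w 0, ~~ w 1 & w 3] ==> ~~ w 8.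
have us9 : uniq (s ++ [:: z]) by rewrite cats1 rcons_uniq zs us.
have kL' : known a H (s ++ [:: z]) ([:: 0; 1; 8] :: L).
  by rewrite known_cons known_cat // /edge /= zH.
have : phi (emask (s ++ [:: z]) e) by apply: (mask_check uH pH us9 kL' eH); vm_compute.
by rewrite /phi /= ae be ce.
Qed.

Lemma three e t1 t2 t3 : #|e| = 3 -> t1 \in e -> t2 \in e -> t3 \in e ->
  t1 != t2 -> t3 != t1 -> t3 != t2 -> e = [set t1; t2; t3].
Proof.
move=> e3 e1 e2 + n12 n31 n32; have [z [_ _ ->]] := third e3 e1 e2 n12.
by rewrite !inE (negbTE n31) (negbTE n32) => /eqP->.
Qed.

Lemma inside_full S e : e \in H -> e \subset S -> e \in inside H S.
Proof. by rewrite inE => -> ->. Qed.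

Lemma double_bound : #|H| <= gb #|V| \/ in_comet V H.
Proof.
have [_ h1 h2 h3 h4] := cf.
have ins t : t \in s -> t \in V by move=> ts; apply: (subsetP sV); rewrite inE.
have neq t t' (n m : nat) : nth a s n = t -> nth a s m = t' -> n < 8 -> m < 8 -> n != m -> t != t'.
  by move=> <- <- n8 m8; rewrite nth_uniq.
have card_pre n : n <= 8 -> #|[set t in take n s]| = n.
  by move=> n8; rewrite card_seq ?take_uniq // size_take; case: ltngtP n8.
have V8 : 8 <= #|V|.
  by rewrite -(card_pre 8 (leqnn 8)); apply: subset_leq_card; rewrite take_oversize.
have dis3 e : [disjoint e & [set a; b; p]] = [&& a \notin e, b \notin e & p \notin e].
  by rewrite disjoint_sym -setI_eq0 !setIUl !setU_eq0 !setI_eq0 !disjoints1 andbA.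
have dis2 e : [disjoint e & [set a; b]] = (a \notin e) && (b \notin e).
  by rewrite disjoint_sym -setI_eq0 !setIUl !setU_eq0 !setI_eq0 !disjoints1.
have disc e t1 t2 : [disjoint e & [set c; t1; t2]] = [&& c \notin e, t1 \notin e & t2 \notin e].
  by rewrite disjoint_sym -setI_eq0 !setIUl !setU_eq0 !setI_eq0 !disjoints1 andbA.
have cub e : a \notin e -> b \notin e -> e \in H ->
    ~~ [disjoint e & [set c; u; v]] -> ~~ [disjoint e & [set c; x; y]] -> c \in e.
  move=> ae be eH; rewrite !disc; case ce: (c \in e) => //=.
  by rewrite -!negb_or !negbK => uv xy; rewrite (double_uvxy eH) in ce.
have triV t1 t2 t3 (A : {set T}) : t1 \in V -> t2 \in V -> t3 \in V ->
    [disjoint [set t1; t2; t3] & A] -> [set t1; t2; t3] \subset V :\: A.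
  by move=> t1V t2V t3V d; rewrite subsetD d !subUset !sub1set t1V t2V t3V.
have [aV bV pV cV] : [/\ a \in V, b \in V, p \in V & c \in V].
  by split; apply: ins; rewrite !inE eqxx ?orbT.
have [uV vV xV yV] : [/\ u \in V, v \in V, x \in V & y \in V].
  by split; apply: ins; rewrite !inE eqxx ?orbT.
have star_out t t' X : X \subset [set a; b; p] -> [set c; t; t'] \in H -> 
    t \in [:: u; x] -> t' \in [:: v; y] -> [set c; t; t'] \subset V :\: X.
  move=> Xs _; rewrite !inE => tu tv.
  have tV : t \in V by case/orP: tu => /eqP->.
  have tV' : t' \in V by case/orP: tv => /eqP->.
  apply: triV => //; apply: disjointWr Xs _.
  rewrite dis3 !inE !negb_or; move: us; rewrite /= !inE !negb_or.
  move=> /and4P[/and5P[ab ap ac au /and3P[av ax ay]] /and5P[bp bc bu bv /andP[bx b_y]]].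
  move=> /and5P[pc pu pv px py] _.
  by case/orP: tu => /eqP->; case/orP: tv => /eqP->;
    rewrite ?ac ?au ?av ?ax ?ay ?bc ?bu ?bv ?bx ?b_y ?pc ?pu ?pv ?px ?py.
have star_uv X : X \subset [set a; b; p] -> [set c; u; v] \in inside H (V :\: X).
  by move=> Xs; apply: inside_full => //; apply: star_out => //; rewrite !inE eqxx.
have star_xy X : X \subset [set a; b; p] -> [set c; x; y] \in inside H (V :\: X).
  by move=> Xs; apply: inside_full => //; apply: star_out => //; rewrite !inE eqxx orbT.
have cover_out X e : e \in H -> [disjoint e & X] -> e \in inside H (V :\: X).
  by move=> eH d; apply: inside_full => //; rewrite subsetD oH.
(* An intersecting remainder still contains [cuv] and [cxy]; each of its edges meets both and hence
   passes through [c]. *)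
have centre X e : [set a; b] \subset X -> X \subset [set a; b; p] ->
    ~ has_match (inside H (V :\: X)) -> e \in inside H (V :\: X) -> c \in e.
  move=> abX Xs /no_matchP iX eX; have uvX := iX _ _ eX (star_uv _ Xs).
  have xyX := iX _ _ eX (star_xy _ Xs); move: eX; rewrite inE => /andP[eH].
  rewrite subsetD => /andP[_ eX]; have : [disjoint e & [set a; b]] by apply: disjointWr eX.
  by rewrite dis2 => /andP[ae be]; apply: cub.
case: (boolP [forall e in H, [|| a \in e, b \in e | p \in e] ==> (e \subset [set a; b; p; c])]).
  move=> /forall_inP hK; set X := [set a; b; p].
  have X3 : #|X| = 3 by rewrite -(card_pre 3) //=; apply: eq_card => t; rewrite !inE !orbA.
  have XV : X \subset V by rewrite !subUset !sub1set aV bV pV.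
  have Q4 : #|[set a; b; p; c]| = 4.
    by rewrite -(card_pre 4) //=; apply: eq_card => t; rewrite !inE !orbA.
  case: (has_matchP (inside H (V :\: X))) => [M|nM].
    have gR := good_inside gH (V :\: X).
    have uR : uni3 (inside H (V :\: X)) by case: gR.
    have := match_card uR (@on_inside _ H _) M.
    have cR := cardD_sub XV; rewrite cR X3 => V9.
    have ltR : #|V :\: X| < #|V| by rewrite cR X3; card_lia.
    left; have := IH ltR gR (@on_inside _ H _) M; rewrite cR X3 => cR'.
    have : #|inside H [set a; b; p; c]| <= 4.
      have := @card_triples T (inside H [set a; b; p; c]) [set a; b; p; c].
      rewrite Q4; apply; last exact: on_inside.
      by have [] := good_inside gH [set a; b; p; c].
    have HE : H \subset inside H [set a; b; p; c] :|: inside H (V :\: X).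
      apply/subsetP=> e eH; rewrite in_setU; have := implyP (hK e eH).
      case abp: ([|| a \in e, b \in e | p \in e]).
        by move=> /(_ isT) eQ; rewrite inside_full.
      by move=> _; rewrite [R in _ || R]cover_out ?orbT // dis3 -!negb_or abp.
    have := subset_leq_card HE; have := cardU_le (inside H [set a; b; p; c]) (inside H (V :\: X)).
    have := @gb_K4 #|V|; card_lia.
  (* The remainder is now a star at [c], which is exactly the comet structure with hub [{a,b,p}]. *)
  right; exists c, X; split=> //.
    by rewrite !inE !negb_or; apply/andP; split; [apply/andP; split|];
      [apply: (neq _ _ 3 0) | apply: (neq _ _ 3 1) | apply: (neq _ _ 3 2)].
  move=> e eH; have := implyP (hK e eH).
  case abp: ([|| a \in e, b \in e | p \in e]).
    move=> /(_ isT) eQ; apply/orP; left; apply: subset_trans eQ _.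
    by apply/subsetP=> t; rewrite !inE orbC.
  move=> _; have eX : [disjoint e & X] by rewrite dis3 -!negb_or abp.
  rewrite eX andbT; apply/orP; right; apply: (centre X) => //; last exact: cover_out.
  exact: subsetUl.
rewrite negb_forall => /existsP[e0]; rewrite !negb_imply => /and3P[e0H abp0 e0Q].
left; set X := [set a; b].
have Xs : X \subset [set a; b; p] by apply: subsetUl.
have XV : X \subset V by rewrite subUset !sub1set aV bV.
have X2 : #|X| = 2 by rewrite -(card_pre 2) //=; apply: eq_card => t; rewrite !inE.
(* The edge [e0] rules out [apc] and [bpc] by [double_K4], so no edge separates [a] from [b]. *)
have twin e : e \in H -> (a \in e) || (b \in e) -> (a \in e) && (b \in e).
  move=> eH ab; case ax: ((a \in e) (+) (b \in e)); last first.
    by move: ab ax; case: (a \in e); case: (b \in e).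
  have /andP[pe ce] := double_cross eH ax.
  have pc : p != c by apply: (neq _ _ 2 3).
  case/negP: e0Q; have [ae|be] := orP ab.
    apply: (@double_K4 a) => //; first by rewrite inE eqxx.
    rewrite -(three (uH eH) ae pe ce) //; [exact: (neq _ _ 0 2) | exact: (neq _ _ 3 0) |].
    by rewrite eq_sym.
  apply: (@double_K4 b) => //; first by rewrite !inE eqxx orbT.
  rewrite -(three (uH eH) be pe ce) //; [exact: (neq _ _ 1 2) | exact: (neq _ _ 3 1) |].
  by rewrite eq_sym.
set P := [set e in H | (a \in e) || (b \in e)].
(* The third vertex of an edge through [a] and [b] lies outside these six, which gives the [6] in
   [gb_twin6] and [gb_star]. *)
pose Y := [set a; b; u; v; x; y].
have YV : Y \subset V by rewrite !subUset !sub1set aV bV uV vV xV yV.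
have Y6 : #|Y| = 6.
  have <- : #|[set t in [:: a; b; u; v; x; y]]| = 6.
    by rewrite card_seq // (mask_uniq us [:: true; true; false; false; true; true; true; true]).
  by apply: eq_card => t; rewrite !inE !orbA.
have ab : a != b by apply: (neq _ _ 0 1).
have cP : #|P| <= #|V| - 6.
  rewrite -Y6 -cardD_sub //; apply: (@card_pair _ _ a b) => // [e|e].
    by rewrite inE => /andP[/uH].
  rewrite inE => /andP[eH abe]; have /andP[ae be] := twin e eH abe; split=> //.
  apply/subsetP=> t; rewrite !inE => /and3P[tb ta te].
  rewrite (subsetP (oH eH)) // andbT (negbTE ta) (negbTE tb) /=.
  case/orP: (double_ab eH abe) => [eQ|/and5P[_ _ ue ve /andP[xe ye]]]; last first.
    by rewrite !negb_or; do !(apply/andP; split); apply: contraTneq te => ->.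
  have := subsetP eQ t te; rewrite !inE (negbTE ta) (negbTE tb) /=.
  move: us; rewrite /= !inE !negb_or => /and5P[_ _ /and5P[_ pu pv px py] /and4P[cu cv cx cy] _].
  by case/orP=> /eqP->; rewrite ?(negbTE pu) ?(negbTE pv) ?(negbTE px) ?(negbTE py)
     ?(negbTE cu) ?(negbTE cv) ?(negbTE cx) ?(negbTE cy).
have HE : H \subset P :|: inside H (V :\: X).
  apply/subsetP=> e eH; rewrite in_setU [e \in P]inE eH /=.
  case abe: ((a \in e) || (b \in e)) => //=; apply: cover_out => //; by rewrite dis2 -negb_or abe.
have := subset_leq_card HE; have cU := cardU_le P (inside H (V :\: X)).
have cR := cardD_sub XV; rewrite X2 in cR.
case: (has_matchP (inside H (V :\: X))) => [M|nM].
  have gR := good_inside gH (V :\: X).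
  have ltR : #|V :\: X| < #|V| by rewrite cR; card_lia.
  have := IH ltR gR (@on_inside _ H _) M; rewrite cR => cR'.
  have := gb_twin6 V8; card_lia.
(* Otherwise [e0] contains [p], and as an edge of the remaining star also [c], against
   [double_pc]. *)
have abe0 : (a \in e0) || (b \in e0).
  apply: contraT; rewrite negb_or => /andP[ae be].
  have e0R : e0 \in inside H (V :\: X) by apply: cover_out => //; rewrite dis2 ae be.
  have pe : p \in e0 by move: abp0; rewrite (negbTE ae) (negbTE be).
  have := double_pc e0H ae be pe; rewrite (centre X) //.
have /andP[ae0 be0] := twin _ e0H abe0.
have [z [za zb e0E]] := third (uH e0H) ae0 be0 ab.
have zs : z \notin s.
  case/orP: (double_ab e0H abe0) => [eQ|]; first by rewrite eQ in e0Q.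
  case/and5P=> _ _ ue ve /andP[xe ye].
  have ze : z \in e0 by rewrite e0E !inE eqxx orbT.
  have zpc t : t \in [set p; c] -> z != t.
    move=> tpc; apply: contraNneq e0Q => zt; rewrite e0E zt.
    rewrite !subUset !sub1set !inE !eqxx ?orbT /=.
    by move: tpc; rewrite !inE => /orP[] ->; rewrite ?orbT.
  rewrite !inE !negb_or za zb (zpc p) ?(zpc c) ?inE ?eqxx ?orbT //=.
  by do !(apply/andP; split); apply: contraTneq ze => ->.
(* The edges of the star at [c] avoid [a], [b], [p] and [z], so their other two vertices lie outside
   [Z]. *)
pose Z := [set t in [:: a; b; p; c; z]].
have zV : z \in V by apply: (subsetP (oH e0H)); rewrite e0E !inE eqxx orbT.
have Z5 : #|Z| = 5.
  rewrite card_seq // (_ : [:: a; b; p; c; z] = rcons (take 4 s) z) // rcons_uniq take_uniq // andbT.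
  by apply: contra zs; apply: mem_take.
have ZV : Z \subset V by apply/subsetP=> t; rewrite !inE; do 4 (case/orP=> [/eqP->//|]); move=> /eqP->.
have V9 : 9 <= #|V|.
  have <- : #|[set t in z :: s]| = 9 by rewrite card_seq //= zs.
  by apply: subset_leq_card; apply/subsetP=> t; rewrite inE in_cons => /orP[/eqP->//|/ins].
have cS : #|inside H (V :\: X)| <= 'C(#|V| - 5, 2).
  rewrite -Z5 -cardD_sub //; apply: (@card_link _ _ c) => [e|e eR].
    by rewrite inE => /andP[/uH].
  have ce := centre X e (subxx _) Xs nM eR; split=> //.
  move: eR; rewrite inE subsetD dis2 => /and4P[eH eV ae be].
  have pe : p \notin e by apply: contraL ce => pe; apply: double_pc.
  have ze : z \notin e by apply: double_page => //; rewrite -e0E.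
  apply/subsetP=> t; rewrite !inE !negb_or => /andP[tc te]; rewrite tc (subsetP eV) // andbT.
  by do !(apply/andP; split) => //; apply: contraTneq te => ->.
have := gb_star V9; card_lia.
Qed.

End Double.
End Configurations.

(** * No two edges meeting only in the centre *)

Section Single.
Variable T : finType.
Implicit Types (e f g S V W X : {set T}) (s : seq T).

(** Either at most one of the three sets is nonempty, or each has at most one element. *)
Lemma card3_max (W A B D : {set T}) : A \subset W -> B \subset W -> D \subset W ->
  (forall x y, x \in A -> y \in B -> x = y) -> (forall x y, x \in A -> y \in D -> x = y) ->
  (forall x y, x \in B -> y \in D -> x = y) -> #|A| + #|B| + #|D| <= maxn 3 #|W|.
Proof.
have pair (X Y : {set T}) : (forall x y, x \in X -> y \in Y -> x = y) ->
    #|X| = 0 \/ #|Y| = 0 \/ #|X| <= 1 /\ #|Y| <= 1.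
  move=> XY; case: (set_0Vmem X) => [->|[x xX]]; first by rewrite cards0; left.
  case: (set_0Vmem Y) => [->|[y yY]]; first by rewrite cards0; right; left.
  right; right; split.
    rewrite -(cards1 y); apply: subset_leq_card; apply/subsetP=> t tX.
    by rewrite inE (XY t y).
  rewrite -(cards1 x); apply: subset_leq_card; apply/subsetP=> t tY.
  by rewrite inE (XY x t).
move=> /subset_leq_card AW /subset_leq_card BW /subset_leq_card DW.
move=> /pair AB /pair AD /pair BD.
move: AB AD BD; move: #|A| #|B| #|D| #|W| AW BW DW => *; lia.
Qed.

Variables (H : {set {set T}}) (V : {set T}).
Hypotheses (gH : good H) (oH : on H V) (V7 : 7 <= #|V|) (IH : bounded_below T #|V|).
Hypothesis noconf2 : forall a b p c u v x y, ~ conf2 H a b p c u v x y.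

Let uH : uni3 H. Proof. by case: gH. Qed.
Let pH : path_free H. Proof. by case: gH. Qed.

Section Labels.
Variables a b p c u v : T.
Hypothesis cf : conf H a b p c u v.

Let s := [:: a; b; p; c; u; v].
Let L := [:: [:: 0; 1; 2]; [:: 0; 1; 3]; [:: 3; 4; 5]].
Let us : uniq s. Proof. by case: cf. Qed.
Let kL : known a H s L.
Proof. by case: cf => _ h1 h2 h3; rewrite /known /edge /= h1 h2 h3. Qed.
Let S := [set t in s].
Let W := V :\: S.

Definition completions y z := [set x in W | [set y; z; x] \in H].

Let sV : S \subset V.
Proof.
have [_ /oH h1 /oH h2 /oH h3] := cf; move: h1 h2 h3; rewrite !subUset !sub1set.
move=> /andP[/andP[aV bV] pV] /andP[_ cV] /andP[/andP[_ uV] vV].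
apply/subsetP=> t; rewrite !inE.
by do 5 (case/orP=> [/eqP->//|]); move=> /eqP->.
Qed.

Let cS : #|S| = 6. Proof. by rewrite card_seq. Qed.
Let cW : #|V| = 6 + #|W|. Proof. by rewrite cardD_sub // cS subnKC // ltnW. Qed.

Lemma uniq_label1 x : x \in W -> uniq (s ++ [:: x]).
Proof. by rewrite in_setD [x \in S]inE cats1 rcons_uniq us andbT => /andP[]. Qed.

Lemma uniq_label2 x y : x \in W -> y \in W -> x != y -> uniq (s ++ [:: x; y]).
Proof.
move=> /setDP[_ +] /setDP[_ +] xy; rewrite [x \in S]inE [y \in S]inE => xs ys.
by rewrite cat_uniq us /= orbF negb_or xs ys inE xy.
Qed.

Lemma completion e y z : e \in H -> y \in e -> z \in e -> y != z ->
  all (fun t => (t \in e) ==> (t == y) || (t == z)) s ->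
  exists2 x, x \in completions y z & e = [set y; z; x].
Proof.
move=> eH ye ze yz /allP al; have [x [xy xz eE]] := third (uH eH) ye ze yz.
have xe : x \in e by rewrite eE !inE eqxx orbT.
exists x => //; rewrite inE -eE eH andbT in_setD (subsetP (oH eH)) // andbT inE.
by apply/negP=> /al; rewrite xe (negbTE xy) (negbTE xz).
Qed.

Definition at_p := [set e in H | (p \in e) && (e :\ p \subset W)].

(** Besides three bits, seven masks survive the path test. The last one, [c] with two vertices of
    [W], is not excluded by a path but would produce a [conf2]. *)
Lemma single_cover e : e \in H ->
  [|| e \in inside H S, e \in inside H W, e \in at_p,
      e \in [set [set a; b; x] | x in completions a b],
      e \in [set [set c; u; x] | x in completions c u],
      e \in [set [set c; v; x] | x in completions c v] |
      e \in [set [set u; v; x] | x in completions u v]].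
Proof.
move=> eH.
pose phi m := (count id m == 3) || (m \in [seq [seq i \in (J : seq nat) | i <- iota 0 6] |
   J <- [:: [::]; [:: 0; 1]; [:: 3; 4]; [:: 3; 5]; [:: 4; 5]; [:: 2]; [:: 3]]]).
have : phi (emask s e) by apply: (mask_check uH pH us kL eH); vm_compute.
have eV := oH eH.
case/orP=> [/eqP c3|mem]; first by rewrite inside_full // (count3_sub uH us eH c3).
have neq t t' (n m : nat) : nth a s n = t -> nth a s m = t' -> n < 6 -> m < 6 -> n != m -> t != t'.
  by move=> <- <- n8 m8; rewrite nth_uniq.
have img t1 t2 : t1 \in e -> t2 \in e -> t1 != t2 ->
    all (fun t => (t \in e) ==> (t == t1) || (t == t2)) s ->
    e \in [set [set t1; t2; x] | x in completions t1 t2].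
  by move=> e1 e2 n12 al; have [x xC ->] := completion eH e1 e2 n12 al; apply: imset_f.
rewrite !inE in mem; move: mem.
case/orP=> [/eqP[ae be pe ce ue ve]|].
  suff -> : e \in inside H W by rewrite orbT.
  apply: inside_full => //; rewrite subsetD eV; apply/pred0P=> t /=; apply/negP=> /andP[te].
  rewrite !inE; do 5 (case/orP=> [/eqP tE|]; first by rewrite -tE te in ae be pe ce ue ve).
  by move=> /eqP tE; rewrite -tE te in ve.
case/orP=> [/eqP[ae be pe ce ue ve]|].
  by rewrite img ?orbT //= ?ae ?be ?pe ?ce ?ue ?ve ?eqxx ?orbT //; apply: (neq _ _ 0 1).
case/orP=> [/eqP[ae be pe ce ue ve]|].
  by rewrite (img c u) ?orbT //= ?ae ?be ?pe ?ce ?ue ?ve ?eqxx ?orbT //; apply: (neq _ _ 3 4).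
case/orP=> [/eqP[ae be pe ce ue ve]|].
  by rewrite (img c v) ?orbT //= ?ae ?be ?pe ?ce ?ue ?ve ?eqxx ?orbT //; apply: (neq _ _ 3 5).
case/orP=> [/eqP[ae be pe ce ue ve]|].
  by rewrite (img u v) ?orbT //= ?ae ?be ?pe ?ce ?ue ?ve ?eqxx ?orbT //; apply: (neq _ _ 4 5).
case/orP=> [/eqP[ae be pe ce ue ve]|/eqP[ae be pe ce ue ve]].
  suff eW : e :\ p \subset W by rewrite [e \in at_p]inE eH pe eW !orbT.
  apply/subsetP=> t; rewrite in_setD1 => /andP[tp te]; rewrite in_setD (subsetP eV) // andbT.
  rewrite !inE (negbTE tp) /=; apply/negP.
  do 4 (case/orP=> [/eqP tE|]; first by rewrite -tE te in ae be ce ue ve).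
  by move=> /eqP tE; rewrite -tE te in ve.
have [x [y [xc yc xy eE]]] := others (uH eH) ce.
have out t : t \in e -> t != c -> t \notin s.
  move=> te tc; rewrite !inE (negbTE tc) /=; apply/negP.
  do 4 (case/orP=> [/eqP tE|]; first by rewrite -tE te in ae be pe ue ve).
  by move=> /eqP tE; rewrite -tE te in ve.
have xs : x \notin s by apply: out; rewrite // eE !inE eqxx orbT.
have ys : y \notin s by apply: out; rewrite // eE !inE eqxx orbT.
case: (@noconf2 a b p c u v x y); have [_ h1 h2 h3] := cf; split; rewrite -?eE //.
rewrite -[X in uniq X]/(s ++ [:: x; y]) cat_uniq us /= orbF negb_or xs ys inE xy.
by [].
Qed.

Lemma card_completions y z : #|completions y z| <= #|W|.
Proof. by apply: subset_leq_card; apply/subsetP=> x; rewrite inE => /andP[]. Qed.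

Lemma at_p_card : #|at_p| <= 'C(#|W|, 2).
Proof.
by apply: (@card_link _ _ p) => [e|e]; rewrite inE => /and3P[eH pe eW] //; apply: uH.
Qed.

Lemma single_count : #|H| <= #|inside H S| + #|inside H W| + #|at_p| + #|completions a b| +
  (#|completions c u| + #|completions c v| + #|completions u v|).
Proof.
have HE : H \subset inside H S :|: (inside H W :|: (at_p :|:
    ([set [set a; b; x] | x in completions a b] :|:
    ([set [set c; u; x] | x in completions c u] :|:
    ([set [set c; v; x] | x in completions c v] :|:
     [set [set u; v; x] | x in completions u v]))))).
  by apply/subsetP=> e /single_cover; rewrite !in_setU.
apply: leq_trans (subset_leq_card HE) _.
rewrite -!addnA; do 3 (apply: leq_trans (cardU_le _ _) _; rewrite leq_add2l).
apply: leq_trans (cardU_le _ _) _; apply: leq_add; first exact: leq_imset_card.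
do 2 (apply: leq_trans (cardU_le _ _) _; apply: leq_add; first exact: leq_imset_card).
exact: leq_imset_card.
Qed.

Let kL2 r : known a H (s ++ r) L. Proof. exact: known_cat. Qed.

(** For distinct [x], [y] the edges [cux], [cvy] would give a [conf2], while [abc], [cux], [uvy] and
    [abc], [cvx], [uvy] are paths. *)
Lemma single_cuv : #|completions c u| + #|completions c v| + #|completions u v| <= maxn 3 #|W|.
Proof.
have sub y z : completions y z \subset W by apply/subsetP=> x; rewrite inE => /andP[].
have compl z y z' : z \in completions y z' -> z \in W /\ [set y; z'; z] \in H.
  by rewrite inE => /andP[].
apply: card3_max => // x y /compl[xW xH] /compl[yW yH].
- apply/eqP; apply: contraT => xy; case: (@noconf2 a b p c u x v y).
  have [_ h1 h2 h3] := cf; split=> //; have := uniq_label2 xW yW xy.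
  rewrite (_ : uniq (s ++ [:: x; y]) = uniq ([:: a; b; p; c; u] ++ [:: v] ++ [:: x] ++ [:: y])) //.
  by rewrite (perm_uniq (s2 := [:: a; b; p; c; u; x; v; y])) //
    (perm_cat2l [:: a; b; p; c; u]) (perm_catCA [:: v] [:: x] [:: y]).
- apply/eqP; apply: contraT => xy; have us8 := uniq_label2 xW yW xy.
  have := @known_path _ a _ pH (s ++ [:: x; y]) ([:: 3; 4; 6] :: [:: 4; 5; 7] :: L) us8.
  by rewrite 2!known_cons kL2 /edge /= xH yH => /(_ isT).
- apply/eqP; apply: contraT => xy; have us8 := uniq_label2 xW yW xy.
  have := @known_path _ a _ pH (s ++ [:: x; y]) ([:: 3; 5; 6] :: [:: 4; 5; 7] :: L) us8.
  by rewrite 2!known_cons kL2 /edge /= xH yH => /(_ isT).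
Qed.

Lemma few_S k r t : uniq (s ++ r) -> wf_edge (size (s ++ r)) t -> edge a (s ++ r) t \in H ->
  few_inside 6 k (t :: L) -> #|inside H S| <= k.
Proof.
move=> usr wt tH; apply: (@few_insideP _ a _ uH pH k s r) => //.
by rewrite known_cons wt tH kL2.
Qed.

Lemma IH_W X : #|inside H (W :\: X)| <= ub #|W :\: X|.
Proof.
apply: (IH_ub gH IH); apply: leq_ltn_trans (_ : #|W| < _).
  by apply: subset_leq_card; apply: subsetDl.
by rewrite cW -addn1 addnC leq_add2r.
Qed.

Lemma meet_S e : e \subset W -> all (fun t => t \notin e) s.
Proof.
move=> eW; apply/allP=> t ts; apply/negP=> /(subsetP eW).
by rewrite !in_setD [t \in S]inE ts.
Qed.

Lemma at_p_twin e0 e : e0 \in at_p -> e \in H -> (a \in e) || (b \in e) ->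
  (a \in e) && (b \in e).
Proof.
rewrite inE => /and3P[e0H pe0 e0W] eH abe.
have [x [y [xp yp xy e0E]]] := others (uH e0H) pe0.
have xW : x \in W by apply: (subsetP e0W); rewrite e0E !inE xp eqxx orbT.
have yW : y \in W by apply: (subsetP e0W); rewrite e0E !inE yp eqxx orbT.
have us8 := uniq_label2 xW yW xy.
have kL8 : known a H (s ++ [:: x; y]) ([:: 2; 6; 7] :: L).
  by rewrite known_cons kL2 /edge /= -e0E e0H.
pose phi m := let w := nth false m in (w 0 || w 1) ==> w 0 && w 1.
have : phi (emask (s ++ [:: x; y]) e) by apply: (mask_check uH pH us8 kL8 eH); vm_compute.
by rewrite /phi /= abe.
Qed.

(** [e0] and [cuv] are disjoint and survive the deletion of the twins [a], [b], so the induction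
    hypothesis applies. Below 11 vertices [gb] grows too slowly for this, and [at_p_small] counts
    directly. *)
Lemma at_p_large e0 : e0 \in at_p -> 11 <= #|V| -> #|H| <= gb #|V|.
Proof.
move=> e0p V11; set X := [set a; b].
have [_ h1 h2 h3] := cf.
have ab : a != b by move: us; rewrite /= inE negb_or => /andP[/andP[]].
have XV : X \subset V.
  by apply: subset_trans sV; rewrite subUset !sub1set !inE !eqxx orbT.
have X2 : #|X| = 2 by rewrite cards2 ab.
have dis2 e : [disjoint e & X] = (a \notin e) && (b \notin e).
  by rewrite disjoint_sym -setI_eq0 !setIUl !setU_eq0 !setI_eq0 !disjoints1.
set P := [set e in H | (a \in e) || (b \in e)].
have cP : #|P| <= #|V| - 2.
  rewrite -X2 -cardD_sub //; apply: (@card_pair _ _ a b) => // [e|e].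
    by rewrite inE => /andP[/uH].
  rewrite inE => /andP[eH abe]; have /andP[ae be] := at_p_twin e0p eH abe; split=> //.
  by apply/subsetP=> t; rewrite !inE negb_or => /and3P[-> -> /(subsetP (oH eH))].
have HE : H \subset P :|: inside H (V :\: X).
  apply/subsetP=> e eH; rewrite in_setU [e \in P]inE eH /=.
  case abe: ((a \in e) || (b \in e)) => //=; apply: inside_full => //.
  by rewrite subsetD oH // dis2 -negb_or abe.
move: (e0p); rewrite inE => /and3P[e0H pe0 e0W].
have e0out t : t \in s -> t != p -> t \notin e0.
  move=> ts tp; apply/negP=> te; have := subsetP e0W t; rewrite in_setD1 tp te => /(_ isT).
  by rewrite in_setD [t \in S]inE ts.
have := us; rewrite /= !inE !negb_or.
move=> /and5P[/and5P[_ ap ac au av] /and4P[bp bc bu bv] /and3P[pc pu pv] _ _].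
have M : has_match (inside H (V :\: X)).
  exists e0, [set c; u; v]; split.
  - apply: inside_full => //; rewrite subsetD oH // dis2.
    by rewrite !e0out // !inE eqxx ?orbT.
  - apply: inside_full => //; rewrite subsetD oH // dis2 !inE !negb_or.
    by rewrite ac au av bc bu bv.
  rewrite disjoint_sym -setI_eq0 !setIUl !setU_eq0 !setI_eq0 !disjoints1.
  by rewrite !e0out // 1?eq_sym // !inE eqxx ?orbT.
have cR := cardD_sub XV; rewrite X2 in cR.
have ltR : #|V :\: X| < #|V| by rewrite cR; card_lia.
have := IH ltR (good_inside gH _) (@on_inside _ H _) M; rewrite cR => cR'.
have := subset_leq_card HE; have := cardU_le P (inside H (V :\: X)).
have := gb_twin V11; card_lia.
Qed.

Lemma at_p_small e0 : e0 \in at_p -> #|V| <= 10 -> #|H| <= gb #|V|.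
Proof.
rewrite inE => /and3P[e0H pe0 e0W] V10.
have [x [y [xp yp xy e0E]]] := others (uH e0H) pe0.
have xW : x \in W by apply: (subsetP e0W); rewrite e0E !inE xp eqxx orbT.
have yW : y \in W by apply: (subsetP e0W); rewrite e0E !inE yp eqxx orbT.
have us8 := uniq_label2 xW yW xy.
have tH : edge a (s ++ [:: x; y]) [:: 2; 6; 7] \in H by rewrite /edge /= -e0E.
have kL8 : known a H (s ++ [:: x; y]) ([:: 2; 6; 7] :: L) by rewrite known_cons kL2 tH.
have c6 : #|inside H S| <= 6.
  by apply: (few_S (t := [:: 2; 6; 7]) us8) => //; vm_compute.
have cxy : #|W :\ x :\ y|.+2 = #|W|.
  by rewrite (cardsD1 x W) xW (cardsD1 y (W :\ x)) in_setD1 yW eq_sym xy.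
have w4 : 1 < #|W| <= 4.
  have V10' : 6 + #|W| <= 10 by rewrite -cW.
  by apply/andP; split; [rewrite -cxy | rewrite -(leq_add2l 6)].
(* An edge of [W] meeting [pxy] in one vertex would form a path with [abp], and one missing both [x]
   and [y] does not fit into the at most two other vertices of [W]. *)
have cWW : #|inside H W| <= #|W| - 2.
  rewrite -cxy subn2 /=; apply: (@card_pair _ _ x y) => // [e|e].
    by rewrite inE => /andP[/uH].
  rewrite inE => /andP[eH eW].
  pose phi m := let w := nth false m in
    [|| w 0, w 1, w 2, w 3, w 4, w 5 | w 6 == w 7].
  have : phi (emask (s ++ [:: x; y]) e) by apply: (mask_check uH pH us8 kL8 eH); vm_compute.
  have := meet_S eW; rewrite /= => /and5P[/negbTE-> /negbTE-> /negbTE-> /negbTE->].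
  move=> /and3P[/negbTE-> /negbTE-> _]; rewrite /phi /=.
  case xe: (x \in e); case ye: (y \in e) => // _.
    by split=> //; apply: setSD; apply: setSD.
  have : e \subset W :\ x :\ y by rewrite !subsetD1 eW xe ye.
  move=> /subset_leq_card; rewrite (uH eH); case/andP: w4; card_lia.
have := single_count; have := gb6 w4; rewrite -cW.
have := single_cuv; have := at_p_card; have := card_completions a b; card_lia.
Qed.

(** The kind of edge leaving the six vertices limits the triples inside, by [few_inside]: 8 with
    some [uvx], 11 with some [cux], [cvx] or [abx]. Edges at [p] are treated first. *)
Lemma single_bound : #|H| <= gb #|V|.
Proof.
have w0 : 0 < #|W| by move: V7; rewrite cW; card_lia.
have cnt := single_count; have ccuv := single_cuv; have cab := card_completions a b.
have cWW : #|inside H W| <= ub #|W| by have := IH_W set0; rewrite setD0.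
case: (set_0Vmem at_p) => [p0|[e0 e0p]]; last first.
  by case: (leqP #|V| 10); [apply: at_p_small e0p | apply: at_p_large e0p].
rewrite p0 cards0 addn0 in cnt.
case: (set_0Vmem (completions u v)) => [uv0|[x]]; last first.
  rewrite inE => /andP[xW xH].
  have := @few_S 8 [:: x] [:: 4; 5; 6] (uniq_label1 xW) isT xH isT.
  have := gb8 w0; rewrite -cW; card_lia.
have cux y z : (y, z) \in [:: (c, u); (c, v)] -> completions y z != set0 -> #|H| <= gb #|V|.
  move=> yz /set0Pn[x]; rewrite inE => /andP[xW xH].
  have [t [tu tE tP]] : exists t, [/\ wf_edge 7 t, edge a (s ++ [:: x]) t = [set y; z; x] &
      t \in [:: [:: 3; 4; 6]; [:: 3; 5; 6]]].
    by move: yz; rewrite !inE => /orP[] /eqP[-> ->]; [exists [:: 3; 4; 6] | exists [:: 3; 5; 6]].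
  have us7 := uniq_label1 xW; have tH : edge a (s ++ [:: x]) t \in H by rewrite tE.
  have c11 : #|inside H S| <= 11.
    apply: (few_S us7 tu tH).
    by move: tP; rewrite !inE => /orP[] /eqP->; vm_compute.
  have kL7 : known a H (s ++ [:: x]) (t :: L) by rewrite known_cons tu tH kL2.
  (* An edge of [W] through [x] would continue [abc], [cux] or [abc], [cvx] to a path. *)
  have sub : inside H W \subset inside H (W :\: [set x]).
    apply/subsetP=> e; rewrite inE => /andP[eH eW]; apply: inside_full => //.
    rewrite subsetD1 eW; apply/negP=> xe.
    pose phi m := let w := nth false m in [|| w 0, w 1, w 2, w 3, w 4, w 5 | ~~ w 6].
    have : phi (emask (s ++ [:: x]) e).
      apply: (mask_check uH pH us7 kL7 eH).
      by move: tP; rewrite !inE => /orP[] /eqP->; vm_compute.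
    have := meet_S eW; rewrite /= => /and5P[/negbTE-> /negbTE-> /negbTE-> /negbTE->].
    by move=> /and3P[/negbTE-> /negbTE-> _]; rewrite /phi /= xe.
  have := IH_W [set x]; have -> : #|W :\: [set x]| = #|W|.-1 by rewrite (cardsD1 x W) xW.
  have := subset_leq_card sub; have := gb11_cu w0; rewrite -cW; card_lia.
case: (boolP (completions c u == set0)) => [/eqP cu0|]; last by apply: cux; rewrite !inE eqxx.
case: (boolP (completions c v == set0)) => [/eqP cv0|].
  rewrite uv0 cu0 cv0 !cards0 !addn0 in cnt.
  case: (set_0Vmem (completions a b)) => [ab0|[x]].
    have := gb14 #|W|; rewrite addnC [_ + 6]addnC -cW.
    rewrite ab0 cards0 in cnt; case: gH => _ _ /(_ S cS); card_lia.
  rewrite inE => /andP[xW xH].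
  have := @few_S 11 [:: x] [:: 0; 1; 6] (uniq_label1 xW) isT xH isT.
  have := gb11_ab w0; rewrite -cW; card_lia.
by apply: cux; rewrite !inE eqxx orbT.
Qed.

End Labels.
End Single.

(** * The induction for graphs without dense 6-sets *)

Section Good.
Variable T : finType.
Implicit Types (H : {set {set T}}) (V : {set T}).

Lemma good_step H V : bounded_below T #|V| -> good H -> on H V -> has_match H ->
  #|H| <= gb #|V| \/ in_comet V H.
Proof.
move=> IH gH oH mH; have [uH pH sH] := gH.
have V6 := match_card uH oH mH; rewrite leq_eqVlt in V6.
case/orP: V6 => [/eqP V6|V7].
  (* On six vertices [gb] is the sparseness bound 14. *)
  left; rewrite -V6; apply: leq_trans (sH V (esym V6)); apply: subset_leq_card.
  by apply/subsetP=> e eH; rewrite inside_full // oH.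
case: (boolP [exists e in H, exists f in H, exists g in H,
   [&& [disjoint e & f], ~~ [disjoint g & e] & ~~ [disjoint g & f]]]); last first.
  rewrite negb_exists => /forallP nT; left; apply: disconnected_bound => // e f g eH fH gH' ef.
  have := nT e; rewrite eH /= negb_exists => /forallP/(_ f); rewrite fH /= negb_exists.
  by move=> /forallP/(_ g); rewrite gH' ef /= negb_and !negbK.
case/exists_inP=> e eH /exists_inP[f fH /exists_inP[g gH' /and3P[ef ge gf]]].
case: (boolP [exists a, exists b, exists p, exists c, exists u, exists v, exists x, exists y,
  [&& uniq [:: a; b; p; c; u; v; x; y], [set a; b; p] \in H, [set a; b; c] \in H,
    [set c; u; v] \in H & [set c; x; y] \in H]]).
  case/existsP=> a /existsP[b /existsP[p /existsP[c /existsP[u /existsP[v]]]]].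
  case/existsP=> x /existsP[y /and5P[h0 h1 h2 h3 h4]].
  by apply: (@double_bound _ H V gH oH IH a b p c u v x y); split.
move=> nc; left; have [a [b [p [c [u [v cf]]]]]] := conf_exists uH pH eH fH gH' ef ge gf.
apply: (@single_bound _ H V gH oH V7 IH _ a b p c u v cf).
move=> a' b' p' c' u' v' x' y' [h0 h1 h2 h3 h4]; case/negP: nc.
apply/existsP; exists a'; apply/existsP; exists b'; apply/existsP; exists p'.
apply/existsP; exists c'; apply/existsP; exists u'; apply/existsP; exists v'.
by apply/existsP; exists x'; apply/existsP; exists y'; rewrite h0 h1 h2 h3 h4.
Qed.

Lemma good_bounded n : bounded_below T n.
Proof.
elim: n => // n IHn V H; rewrite ltnS leq_eqVlt => /orP[/eqP Vn|]; last exact: IHn.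
move=> gH oH mH; have uH : uni3 H by case: gH.
rewrite -Vn in IHn; case: (good_step IHn gH oH mH) => [/leq_trans|]; first by apply; apply: leq_addr.
move=> /(comet_card uH oH)/leq_trans; apply; apply: gb_comet; exact: match_card mH.
Qed.

Lemma good_bound H V : good H -> on H V -> has_match H ->
  #|H| <= gb #|V| \/ in_comet V H.
Proof. exact: good_step (@good_bounded _). Qed.

Lemma good_ub H V : good H -> on H V -> #|H| <= ub #|V|.
Proof.
move=> gH oH; have HV : H \subset inside H V.
  by apply/subsetP=> e eH; rewrite inside_full // oH.
apply: leq_trans (subset_leq_card HV) _.
exact: (IH_ub gH (@good_bounded #|V|.+1)).
Qed.

End Good.

(** * Dense 6-sets *)

Section Dense.
Variable T : finType.
Implicit Types (H : {set {set T}}) (e f g S V X A B : {set T}) (s : seq T).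

Definition K3 S : {set {set T}} := [set e : {set T} | (e \subset S) && (#|e| == 3)].

Lemma card_K3 S : #|K3 S| = 'C(#|S|, 3).
Proof. exact: cards_draws. Qed.

Lemma inside_K3 H S : uni3 H -> inside H S \subset K3 S.
Proof. by move=> uH; apply/subsetP=> e; rewrite !inE => /andP[/uH-> ->]. Qed.

Lemma uni3_inside H S : uni3 H -> uni3 (inside H S).
Proof. by move=> uH e; rewrite inE => /andP[/uH]. Qed.

Lemma path_free_inside H S : path_free H -> path_free (inside H S).
Proof.
move=> pH e f g; rewrite !inE => /andP[eH _] /andP[fH _] /andP[gH _]; exact: pH.
Qed.

(** More than 10 edges cannot be intersecting, so two disjoint edges label all of [S]. For every way
    in which an edge can meet [S] in one or two vertices, the search then allows at most 14 edges
    inside; this is where the density threshold 15 comes from. *)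
Lemma dense_split H S e : uni3 H -> path_free H -> #|S| = 6 -> 14 < #|inside H S| ->
  e \in H -> (e \subset S) || [disjoint e & S].
Proof.
move=> uH pH S6 dS eH; have [|nM] := has_matchP (inside H S); last first.
  have := intersecting6 (uni3_inside (S := S) uH) (no_matchP nM) S6.
  have -> : inside (inside H S) S = inside H S.
    by apply/setP=> f; rewrite !inE; case: (f \subset S); rewrite ?andbF ?andbT.
  by rewrite leqNgt (leq_trans _ dS).
case=> f [g]; rewrite !inE => -[/andP[fH fS] /andP[gH gS] fg].
have /card_gt0P[x1 x1f] : 0 < #|f| by rewrite uH.
have [x2 [x3 [n21 n31 n23 fE]]] := others (uH _ fH) x1f.
have /card_gt0P[y1 y1g] : 0 < #|g| by rewrite uH.
have [y2 [y3 [m21 m31 m23 gE]]] := others (uH _ gH) y1g.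
pose s := [:: x1; x2; x3; y1; y2; y3].
have us : uniq s.
  rewrite -[s]/([:: x1; x2; x3] ++ [:: y1; y2; y3]) cat_uniq.
  apply/and3P; split; last first.
  - by rewrite /= !inE !negb_or ![y1 == _]eq_sym m21 m31 m23.
  - apply/hasPn=> t; rewrite !inE orbA => tg.
    have tg' : t \in g by rewrite gE !inE.
    by have := disjointFl fg tg'; rewrite fE !inE -orbA => ->.
  by rewrite /= !inE !negb_or ![x1 == _]eq_sym n21 n31 n23.
have SE : S = [set t in s].
  apply/esym/eqP; rewrite eqEcard card_seq // S6 andbT; apply/subsetP=> t.
  have : f :|: g \subset S by rewrite subUset fS gS.
  by move/subsetP/(_ t); rewrite fE gE !inE -!orbA.
pose L := [:: [:: 0; 1; 2]; [:: 3; 4; 5]].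
have kL : known x1 H s L by rewrite /known /edge /= -fE -gE fH gH.
apply: contraLR dS; rewrite negb_or -leqNgt => /andP[eS eS'].
have usr := uniq_outer e us.
have kLr : known x1 H (s ++ outer s e) (pattern (emask s e) :: L).
  have := known_pattern x1 uH us eH; rewrite known_cons known_cons => /and3P[-> -> _].
  by rewrite known_cat.
rewrite SE; apply: (few_insideP uH pH usr kLr).
have : all (fun m => few_inside 6 14 (pattern m :: L)) [seq m <- masks 6 | 0 < count id m < 3].
  by vm_compute.
move=> /allP; apply; rewrite mem_filter -[6](size_emask s e) mem_masks andbT.
have le3 := emask_le3 x1 uH us eH; rewrite lt0n ltn_neqAle le3 andbT; apply/andP; split.
  apply: contra eS' => /eqP c0; apply/pred0P=> t /=; apply/negP=> /andP[te].
  rewrite SE inE => ts; have : has id (emask s e) by apply/hasP; exists (t \in e) => //; apply: map_f.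
  by rewrite has_count c0.
by apply: contra eS => /eqP c3; rewrite SE; apply: (count3_sub uH us eH c3).
Qed.

Lemma sparse_or_dense H : sparse6 H \/ exists2 S : {set T}, #|S| = 6 & 14 < #|inside H S|.
Proof.
case: (boolP [exists S : {set T}, (#|S| == 6) && (14 < #|inside H S|)]).
  by case/existsP=> S /andP[/eqP S6 dS]; right; exists S.
rewrite negb_exists => /forallP sp; left=> S S6.
by have := sp S; rewrite S6 eqxx /= -leqNgt.
Qed.

(** Five vertices span only ten triples. *)
Lemma dense_sub H V S : uni3 H -> on H V -> #|S| = 6 -> 14 < #|inside H S| -> S \subset V.
Proof.
move=> uH oH S6 dS; apply: contraLR dS => nS; rewrite -leqNgt.
have SV5 : #|S :&: V| <= 5.
  by rewrite -ltnS -S6; apply: proper_card; rewrite properE subsetIl subsetI subxx.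
have : inside H S \subset K3 (S :&: V).
  by apply/subsetP=> e; rewrite !inE subsetI => /andP[eH ->]; rewrite oH //= uH.
move=> /subset_leq_card/leq_trans; apply; rewrite card_K3.
by case: #|_| SV5 => [|[|[|[|[|[]]]]]].
Qed.

Lemma dense_decomp H V S : uni3 H -> path_free H -> on H V -> #|S| = 6 ->
  14 < #|inside H S| -> H = inside H S :|: inside H (V :\: S).
Proof.
move=> uH pH oH S6 dS; apply/setP=> e; rewrite in_setU !inE subsetD -andb_orr.
case eH: (e \in H) => //=; rewrite oH //=.
by rewrite (dense_split uH pH S6 dS eH).
Qed.

Lemma dense_card H V S : uni3 H -> path_free H -> on H V -> #|S| = 6 ->
  14 < #|inside H S| -> #|H| <= 20 + #|inside H (V :\: S)|.
Proof.
move=> uH pH oH S6 dS; rewrite {1}(dense_decomp uH pH oH S6 dS).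
apply: leq_trans (cardU_le _ _) _; rewrite leq_add2r.
by apply: leq_trans (subset_leq_card (inside_K3 S uH)) _; rewrite card_K3 S6.
Qed.

(** Serves the case of 13 vertices, where a dense 6-set leaves seven; sparse graphs on seven
    vertices have at most 17 edges. *)
Lemma bound7 H V : uni3 H -> path_free H -> on H V -> #|V| = 7 ->
  #|H| <= 20 /\ (#|H| = 20 -> exists2 S : {set T}, S \subset V /\ #|S| = 6 & H = K3 S).
Proof.
move=> uH pH oH V7; have [sp|[S S6 dS]] := sparse_or_dense H.
  have : #|H| <= ub #|V| by apply: good_ub.
  by rewrite V7 => le17; split; [apply: leq_trans le17 _ | move=> h; rewrite h in le17].
have SV := dense_sub uH oH S6 dS.
have e0 : inside H (V :\: S) = set0.
  apply/eqP; rewrite -cards_eq0 -leqn0.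
  apply: leq_trans (subset_leq_card (inside_K3 (V :\: S) uH)) _.
  by rewrite card_K3 cardD_sub // V7 S6.
have := dense_card uH pH oH S6 dS; rewrite e0 cards0 addn0 => H20; split=> // c20.
exists S => //; apply/eqP; rewrite eqEcard card_K3 S6 c20 andbT.
by rewrite (dense_decomp uH pH oH S6 dS) e0 setU0; apply: inside_K3.
Qed.

Lemma ub17 k : 8 <= k -> ub k + 17 <= 'C(k + 2, 2).
Proof. rewrite addnC [k + 2]addnC; small k 13; large. Qed.

(** With [n - 6] vertices left beside a dense 6-set, 17 makes the total [20 + 'C(n - 4, 2) - 17],
    one short of the comet. *)
Lemma bound8 H V : uni3 H -> path_free H -> on H V -> 8 <= #|V| -> #|H| + 17 <= 'C(#|V| + 2, 2).
Proof.
elim: {V}_.+1 {-2}V (ltnSn #|V|) H => // n IHn V Vn H uH pH oH V8.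
have [sp|[S S6 dS]] := sparse_or_dense H.
  by apply: leq_trans (ub17 V8); rewrite leq_add2r; apply: good_ub.
have SV := dense_sub uH oH S6 dS; have cR := cardD_sub SV; rewrite S6 in cR.
have H20 := dense_card uH pH oH S6 dS; set K := inside H _ in H20.
have uK : uni3 K by apply: uni3_inside. have pK : path_free K by apply: path_free_inside.
have oK : on K (V :\: S) by apply: on_inside.
case: (ltnP 7 #|V :\: S|) => R8.
  have lt : #|V :\: S| < n by rewrite cR; move: Vn V8; clear; move: #|_| => k; lia.
  have := IHn _ lt K uK pK oK R8; move: H20 R8; rewrite cR; clear.
  move: #|H| #|K| #|V| => h k v H20 R8 k17.
  have [j vE] : exists j, v = j + 6 by exists (v - 6); lia.
  subst v.
  by rewrite addnK in R8 k17; rewrite !addnS !addn0 !bin2S; rewrite !addn2 !bin2S in k17; lia.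
have k20 : #|K| <= 20.
  have [R7|R6] := leqP #|V :\: S| 6.
    apply: leq_trans (subset_leq_card (inside_K3 (V :\: S) uH)) _; rewrite card_K3.
    by case: #|_| R7 => [|[|[|[|[|[|[]]]]]]].
  have R7 : #|V :\: S| = 7 by apply/eqP; rewrite eqn_leq R8 R6.
  by have [] := bound7 uK pK oK R7.
case: (ltnP #|V| 12) => V12; last first.
  move: k20 H20 V12; clear; move: #|H| #|K| #|V| => h k v k20 H20 V12.
  have [j vE] : exists j, v = j + 12 by exists (v - 12); lia.
  subst v.
  by rewrite !addnS !addn0 !bin2S; lia.
have : #|K| <= 'C(#|V| - 6, 3).
  by rewrite -cR -card_K3; apply: subset_leq_card; apply: inside_K3.
move: H20 V8 V12; clear; move: #|H| #|K| #|V| => h k v H20.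
do 12 (case: v => [|v] //; try by move=> _ _ k4;
  apply: leq_trans (leq_add (leq_trans H20 (leq_add (leqnn _) k4)) (leqnn _)) _).
Qed.

(** * Sizes and path-freeness of two-block graphs and comets *)

Definition blocks (B1 B2 : {set T}) : {set {set T}} :=
  [set e : {set T} | (#|e| == 3) && ((e \subset B1) || (e \subset B2))].

Definition cometg c (A : {set T}) : {set {set T}} :=
  [set e : {set T} | (#|e| == 3) && ((e \subset c |: A) || (c \in e) && [disjoint e & A])].

Lemma blocksE B1 B2 : blocks B1 B2 = K3 B1 :|: K3 B2.
Proof. by apply/setP=> e; rewrite !inE andb_orr andbC [_ && (e \subset B2)]andbC. Qed.

Lemma card_blocks B1 B2 : [disjoint B1 & B2] -> #|blocks B1 B2| = 'C(#|B1|, 3) + 'C(#|B2|, 3).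
Proof.
move=> d; rewrite blocksE cardsU !card_K3 (_ : K3 B1 :&: K3 B2 = set0) ?cards0 ?subn0 //.
apply/eqP; apply: contraT => /set0Pn[e]; rewrite !inE => /andP[/andP[e1 /eqP e3] /andP[e2 _]].
have : e \subset B1 :&: B2 by rewrite subsetI e1 e2.
by rewrite disjoint_setI0 // subset0 => /eqP e0; rewrite e0 cards0 in e3.
Qed.

Lemma card_cometg c A : #|A| = 3 -> c \notin A -> #|cometg c A| = 4 + 'C(#|T| - 4, 2).
Proof.
move=> A3 cA.
have c4 : #|c |: A| = 4 by rewrite cardsU1 cA A3.
have cC : #|~: (c |: A)| = #|T| - 4 by rewrite -(cardsC (c |: A)) c4 addKn.
pose D := [set e : {set T} | e \subset ~: (c |: A) & #|e| == 2].
have notin e : e \in D -> c \notin e.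
  by rewrite inE => /andP[eC _]; apply/negP=> /(subsetP eC); rewrite !inE eqxx.
have -> : cometg c A = K3 (c |: A) :|: [set c |: e | e in D].
  apply/setP=> e; rewrite in_setU [e \in cometg _ _]inE [e \in K3 _]inE andbC.
  case: (boolP (e \subset c |: A)) => eQ /=.
    by case: (boolP (#|e| == 3)) => //= e3; apply/esym/negP=> /imsetP[f fD eE];
      move: fD eQ; rewrite eE inE => /andP[/subsetP fC /cards2P[x [y [_ fE]]]] /subsetP/(_ x);
      have := fC x; rewrite fE !inE eqxx orbT /= => /(_ isT); case: (_ || _) => // _ /(_ isT).
  apply/andP/imsetP => [[/andP[ce eA] /eqP e3]|[f fD ->]].
    exists (e :\ c); rewrite ?setD1K // inE; apply/andP; split; last first.
      by have := cardsD1 c e; rewrite ce e3 => /eqP; rewrite eqSS eq_sym.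
    apply/subsetP=> t; rewrite !inE => /andP[tc te].
    by rewrite (negbTE tc) (disjointFr eA te).
  have cf := notin f fD; move: fD; rewrite inE => /andP[fC /eqP f2].
  rewrite cardsU1 cf f2 setU11; split=> //=; rewrite -setI_eq0 setIUl setU_eq0 !setI_eq0.
  rewrite disjoints1 cA disjoints_subset; apply: subset_trans fC _.
  by rewrite setCS subsetUr.
rewrite cardsU card_K3 c4 (_ : K3 (c |: A) :&: _ = set0); last first.
  apply/eqP; apply: contraT => /set0Pn[e]; rewrite in_setI => /andP[+ /imsetP[f fD eE]].
  rewrite inE => /andP[eQ _]; move: fD; rewrite inE => /andP[fC /cards2P[x [y [_ fE]]]].
  have xf : x \in f by rewrite fE !inE eqxx.
  have := subsetP fC x xf; have := subsetP eQ x; rewrite eE in_setU1 xf orbT => /(_ isT).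
  by rewrite in_setC => ->.
rewrite cards0 subn0 card_in_imset ?cards_draws ?cC // => e f /notin ce /notin cf ef.
by rewrite -(setU1K ce) ef setU1K.
Qed.

(** The edges of a path span seven vertices, and consecutive ones meet, so all three would lie in
    one block of at most six. *)
Lemma blocks_path_free B1 B2 : [disjoint B1 & B2] -> #|B1| <= 6 -> #|B2| <= 6 ->
  path_free (blocks B1 B2).
Proof.
move=> d s1 s2 e f g; rewrite !inE => /andP[/eqP e3 eB] /andP[/eqP f3 fB] /andP[/eqP g3 gB].
move=> ef fg eg.
have c7 : #|e :|: f :|: g| = 7.
  have : #|(e :|: f) :&: g| = 1.
    by rewrite setIUl (_ : e :&: g = set0) ?set0U //; apply/eqP; rewrite -cards_eq0 eg.
  have := cardsUI (e :|: f) g; have := cardsUI e f; rewrite e3 f3 g3 ef; card_lia.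
have meet X Y : #|X :&: Y| = 1 -> X \subset B1 -> Y \subset B2 -> False.
  move=> xy X1 Y2; have : X :&: Y \subset B1 :&: B2 by apply: setISS.
  by rewrite (disjoint_setI0 d) subset0 => /eqP XY0; rewrite XY0 cards0 in xy.
have fe : #|f :&: e| = 1 by rewrite setIC.
have gf : #|g :&: f| = 1 by rewrite setIC.
case/orP: fB => fB.
  case/orP: eB => eB; last by case: (meet f e fe fB eB).
  case/orP: gB => gB; last by case: (meet f g fg fB gB).
  by have := subset_leq_card (_ : e :|: f :|: g \subset B1);
    rewrite c7 !subUset eB fB gB leqNgt ltnS s1 => /(_ isT).
case/orP: eB => eB; first by case: (meet e f ef eB fB).
case/orP: gB => gB; first by case: (meet g f gf gB fB).
by have := subset_leq_card (_ : e :|: f :|: g \subset B2);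
    rewrite c7 !subUset eB fB gB leqNgt ltnS s2 => /(_ isT).
Qed.

(** Two triples of the 4-set share two vertices, and an edge off [A] meets the 4-set at most in [c].
    So whichever kind the middle edge is, both end edges contain [c] and are not disjoint. *)
Lemma cometg_path_free c A : #|A| = 3 -> c \notin A -> path_free (cometg c A).
Proof.
move=> A3 cA; have Q4 : #|c |: A| = 4 by rewrite cardsU1 cA A3.
have K4 e f : #|e| = 3 -> #|f| = 3 -> e \subset c |: A -> f \subset c |: A -> #|e :&: f| <> 1.
  move=> e3 f3 eQ fQ ef; have : #|e :|: f| <= 4 by rewrite -Q4 subset_leq_card // subUset eQ.
  by have := cardsUI e f; rewrite e3 f3 ef; card_lia.
have mix e f : e \subset c |: A -> [disjoint f & A] -> #|e :&: f| = 1 -> c \in e.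
  move=> eQ fA /eqP/cards1P[x ex]; have : x \in e :&: f by rewrite ex set11.
  rewrite inE => /andP[xe xf]; have := subsetP eQ x xe; rewrite !inE (disjointFr fA xf) orbF.
  by move=> /eqP <-.
have dj (e g : {set T}) : #|e :&: g| = 0 -> c \in e -> c \in g -> False.
  by move=> eg ce cg; have := card0_eq eg c; rewrite !inE ce cg.
move=> e f g; rewrite !inE => /andP[/eqP e3 eC] /andP[/eqP f3 fC] /andP[/eqP g3 gC].
move=> ef fg eg; have gf : #|g :&: f| = 1 by rewrite setIC.
case/orP: fC => [fQ|/andP[cf fA]].
  case/orP: eC => [eQ|/andP[ce eA]]; first exact: (K4 e f).
  case/orP: gC => [gQ|/andP[cg gA]]; first exact: (K4 f g).
  exact: (dj e g).
have ce : c \in e by case/orP: eC => [eQ|/andP[]//]; apply: mix ef.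
have cg : c \in g by case/orP: gC => [gQ|/andP[]//]; apply: mix gf.
exact: (dj e g).
Qed.

End Dense.

(** * Isomorphisms and the extremal graphs *)

Section Transfer.
Variable n : nat.
Implicit Types (H G : {set {set 'I_n}}) (e f g A B : {set 'I_n}).

Lemma nth_inj m (x0 : 'I_n) (s : seq 'I_n) : uniq s -> size s = m ->
  injective (fun i : 'I_m => nth x0 s i).
Proof.
move=> us sm i j /eqP; rewrite nth_uniq ?sm ?ltn_ord // => /eqP; exact: val_inj.
Qed.

Lemma imset3 (V : finType) (f : V -> 'I_n) (a b c : V) : f @: [set a; b; c] = [set f a; f b; f c].
Proof. by rewrite !imsetU1 imset_set1 || rewrite !imsetU !imset_set1. Qed.

Lemma match_contains H : uni3 H -> has_match H -> contains Mmatch H.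
Proof.
move=> uH [e [f [eH fH ef]]].
have /card_gt0P[a ae] : 0 < #|e| by rewrite uH.
have [b [c [ba ca bc eE]]] := others (uH _ eH) ae.
have /card_gt0P[x xf] : 0 < #|f| by rewrite uH.
have [y [z [yx zx yz fE]]] := others (uH _ fH) xf.
have us : uniq [:: a; b; c; x; y; z].
  rewrite -[X in uniq X]/([:: a; b; c] ++ [:: x; y; z]) cat_uniq; apply/and3P; split; last first.
  - by rewrite /= !inE !negb_or ![x == _]eq_sym yx zx yz.
  - apply/hasPn=> t; rewrite !inE orbA => tf.
    have tf' : t \in f by rewrite fE !inE.
    by have := disjointFl ef tf'; rewrite eE !inE -orbA => ->.
  by rewrite /= !inE !negb_or ![a == _]eq_sym ba ca bc.
exists (fun i : 'I_6 => nth a [:: a; b; c; x; y; z] i); split; first exact: nth_inj.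
by move=> d; rewrite !inE => /orP[] /eqP->; rewrite imset3 !inordK //= -?eE -?fE.
Qed.

Lemma contains_match H : contains Mmatch H -> has_match H.
Proof.
case=> f [fi fH]; set e1 := [set (inord 0 : 'I_6); inord 1; inord 2].
set e2 := [set (inord 3 : 'I_6); inord 4; inord 5].
exists (f @: e1), (f @: e2); split; try (by apply: fH; rewrite !inE eqxx ?orbT).
rewrite -setI_eq0 -imsetI ?imset_eq0; last by move=> ? ? _ _; apply: fi.
by apply/eqP/setP=> i; rewrite !inE -!val_eqE /= !inordK //; case: i => [[|[|[|[|[|[]]]]]]].
Qed.

Lemma path_free_Pfree H : path_free H -> Pfree H.
Proof.
move=> pH [f [fi fH]].
have cI (A B : {set 'I_7}) : #|f @: A :&: f @: B| = #|A :&: B|.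
  by rewrite -imsetI ?card_imset // => ? ? _ _; apply: fi.
set e1 := [set (inord 0 : 'I_7); inord 1; inord 2].
set e2 := [set (inord 2 : 'I_7); inord 3; inord 4].
set e3 := [set (inord 4 : 'I_7); inord 5; inord 6].
have mem (e : {set 'I_7}) : [|| e == e1, e == e2 | e == e3] -> f @: e \in H.
  by move=> he; apply: fH; rewrite !inE -orbA.
apply: (pH (f @: e1) (f @: e2) (f @: e3)); rewrite ?mem ?eqxx ?orbT // cI.
- rewrite (_ : _ :&: _ = [set inord 2]) ?cards1 //.
  by apply/setP=> i; rewrite !inE -!val_eqE /= !inordK //; case: i => [[|[|[|[|[|[|[]]]]]]]].
- rewrite (_ : _ :&: _ = [set inord 4]) ?cards1 //.
  by apply/setP=> i; rewrite !inE -!val_eqE /= !inordK //; case: i => [[|[|[|[|[|[|[]]]]]]]].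
rewrite (_ : _ :&: _ = set0) ?cards0 //.
by apply/setP=> i; rewrite !inE -!val_eqE /= !inordK //; case: i => [[|[|[|[|[|[|[]]]]]]]].
Qed.

(** The two shared vertices [c] and [d] differ since [e] and [g] are disjoint; filling in the
    remaining vertices lists the path in order. *)
Lemma Pfree_path_free H : uni3 H -> Pfree H -> path_free H.
Proof.
move=> uH PH e f g eH fH gH ef fg eg; apply: PH.
move/eqP/cards1P: ef => [c efc]; move/eqP/cards1P: fg => [d fgd].
have : c \in e :&: f by rewrite efc set11.
rewrite inE => /andP[ce cf].
have : d \in f :&: g by rewrite fgd set11.
rewrite inE => /andP[df dg].
have eg0 t : t \in e -> t \in g -> False.
  by move=> te tg; have := card0_eq eg t; rewrite !inE te tg.
have cd : c != d by apply/eqP=> cd; apply: (eg0 c); rewrite ?ce // cd.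
have [a [b [ac bc ab eE]]] := others (uH _ eH) ce.
have [x [xc xd fE]] := third (uH _ fH) cf df cd.
have [y [z [yd zd yz gE]]] := others (uH _ gH) dg.
have ef1 t : t \in e -> t \in f -> t = c.
  by move=> te tf; apply/set1P; rewrite -efc inE te tf.
have fg1 t : t \in f -> t \in g -> t = d.
  by move=> tf tg; apply/set1P; rewrite -fgd inE tf tg.
have neg t t' : t \in e -> t' \in g -> t != t'.
  by move=> te tg; apply/eqP=> tt; apply: (eg0 t); rewrite ?te // tt.
have nef t t' : t \in e -> t' \in f -> t != c -> t != t'.
  by move=> te tf tc; apply: contraNneq tc => tt; apply/eqP/ef1; rewrite // tt.
have nfg t t' : t \in f -> t' \in g -> t' != d -> t != t'.
  by move=> te tf tc; apply: contraNneq tc => tt; apply/eqP/fg1; rewrite // -tt.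
have [ae be] : a \in e /\ b \in e by rewrite eE !inE !eqxx !orbT.
have xf : x \in f by rewrite fE !inE eqxx orbT.
have [yg zg] : y \in g /\ z \in g by rewrite gE !inE !eqxx !orbT.
have us : uniq [:: a; b; c; x; d; y; z].
  rewrite /= !inE !negb_or ab ac bc [c == x]eq_sym xc cd xd yz ![d == _]eq_sym yd zd.
  rewrite (neg a d) ?(neg a y) ?(neg a z) ?(neg b d) ?(neg b y) ?(neg b z) ?(neg c y) //.
  by rewrite (neg c z) ?(nef a x) ?(nef b x) ?(nfg x y) ?(nfg x z).
exists (fun i : 'I_7 => nth a [:: a; b; c; x; d; y; z] i); split; first exact: nth_inj.
have e' : [set a; b; c] = e 
  by rewrite eE; apply/setP=> t; rewrite !inE; case: (t == a); case: (t == b); case: (t == c).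
have f' : [set c; x; d] = f 
  by rewrite fE; apply/setP=> t; rewrite !inE; case: (t == x); case: (t == c); case: (t == d).
have g' : [set d; y; z] = g by rewrite gE.
by move=> t; rewrite !inE => /orP[/orP[]|] /eqP->; rewrite imset3 !inordK //= ?e' ?f' ?g'.
Qed.

Lemma iso_sym_props G H : iso G H -> uni3 G -> path_free G -> has_match G ->
  [/\ Pfree H, contains Mmatch H & #|H| = #|G|].
Proof.
case=> f [fi ->] uG pG mG.
have cI A B : #|f @: A :&: f @: B| = #|A :&: B|.
  by rewrite -imsetI ?card_imset // => ? ? _ _; apply: fi.
have uH : uni3 [set f @: e | e : {set 'I_n} in G].
  by move=> _ /imsetP[e eG ->]; rewrite card_imset // uG.
split; last by rewrite card_imset //; apply: imset_inj.
  apply: path_free_Pfree => _ _ _ /imsetP[e1 h1 ->] /imsetP[e2 h2 ->] /imsetP[e3 h3 ->].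
  by rewrite !cI; apply: pG.
apply: match_contains => //; case: mG => e1 [e2 [h1 h2 d]].
exists (f @: e1), (f @: e2); split; try exact: imset_f.
by rewrite -setI_eq0 -cards_eq0 cI cards_eq0 setI_eq0.
Qed.

(** Sorted by colour, the two vertex lists have equal colour sequences since the classes have equal
    sizes; matching positions gives the permutation. *)
Lemma recolor (c c' : 'I_n -> nat) :
  (forall k, #|[set i | c i == k]| = #|[set i | c' i == k]|) ->
  exists2 f : 'I_n -> 'I_n, injective f & forall i, c' (f i) = c i.
Proof.
move=> cc; pose s := sort (relpre c leq) (enum 'I_n); pose s' := sort (relpre c' leq) (enum 'I_n).
have E : map c s = map c' s'.
  rewrite -!sort_map; apply/perm_sortP; [exact: leq_total|exact: leq_trans|exact: anti_leq|].
  apply/allP=> k _; change (count_mem k (map c (enum 'I_n)) == count_mem k (map c' (enum 'I_n))).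
  have cnt (d : 'I_n -> nat) : count (preim d (pred1 k)) (enum 'I_n) = #|[set i | d i == k]|.
    rewrite cardE -size_filter /enum_mem filter_predT; congr size.
    by apply: eq_filter => i; rewrite /= !inE.
  by rewrite (count_map c) (count_map c') !cnt cc.
case: (posnP n) => [n0|n0].
  by exists id => // i; have := ltn_ord i; move: (val i) => k; rewrite n0.
pose x0 := Ordinal n0.
have ss : size s = n by rewrite size_sort size_enum_ord.
have ss' : size s' = n by rewrite size_sort size_enum_ord.
have is_ i : i \in s by rewrite mem_sort mem_enum.
have us' : uniq s' by rewrite sort_uniq enum_uniq.
have ix i : index i s < n by rewrite -[X in _ < X]ss index_mem.
exists (fun i => nth x0 s' (index i s)).
  move=> i j /eqP; rewrite nth_uniq ?ss' // => /eqP ij.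
  by rewrite -(nth_index x0 (is_ i)) ij nth_index.
move=> i; rewrite -(nth_map x0 (c' x0)) ?ss' // -E (nth_map x0) ?ss //.
by rewrite nth_index.
Qed.

(* Colour the vertices by the block containing them. *)
Lemma move_blocks A B (A' B' : {set 'I_n}) : [disjoint A & B] -> [disjoint A' & B'] ->
  #|A| = #|A'| -> #|B| = #|B'| ->
  exists f : 'I_n -> 'I_n, [/\ injective f, f @: A = A' & f @: B = B'].
Proof.
move=> d d' cA cB; pose c (X Y : {set 'I_n}) i := if i \in X then 0 else if i \in Y then 1 else 2.
have c0 X Y : [set i | c X Y i == 0] = X.
  by apply/setP=> i; rewrite inE /c; case: (i \in X) => //; case: (i \in Y).
have c1 (X Y : {set 'I_n}) : [disjoint X & Y] -> [set i | c X Y i == 1] = Y.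
  move=> dXY; apply/setP=> i; rewrite inE /c; case iX: (i \in X) => //.
    by rewrite (disjointFr dXY iX).
  by case: (i \in Y).
have c2 (X Y : {set 'I_n}) : [set i | c X Y i == 2] = ~: (X :|: Y).
  by apply/setP=> i; rewrite !inE /c; case: (i \in X) => //; case: (i \in Y).
have [|f fi fc] := @recolor (c A B) (c A' B').
  case=> [|[|[|k]]]; rewrite ?c0 ?c1 ?c2 //; last first.
    have c3 (X Y : {set 'I_n}) : [set i | c X Y i == k.+3] = set0.
      by apply/setP=> i; rewrite !inE /c; case: (i \in X); case: (i \in Y).
    by rewrite !c3.
  have UE (X Y : {set 'I_n}) : [disjoint X & Y] -> #|~: (X :|: Y)| = n - (#|X| + #|Y|).
    by move=> dXY; rewrite cardsCs setCK card_ord cardsU disjoint_setI0 // cards0 subn0.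
  by rewrite !UE // cA cB.
exists f; split=> //; apply/eqP; rewrite eqEcard card_imset // ?cA ?cB leqnn andbT.
  apply/subsetP=> _ /imsetP[i iA ->]; rewrite -(c0 A' B') inE fc.
  by have := iA; rewrite -{1}(c0 A B) inE.
apply/subsetP=> _ /imsetP[i iB ->]; rewrite -(c1 A' B' d') inE fc.
by have := iB; rewrite -{1}(c1 A B d) inE.
Qed.

(** The moved graph has as many edges as the target, so one inclusion suffices. *)
Lemma blocks_iso A B (A' B' : {set 'I_n}) : [disjoint A & B] -> [disjoint A' & B'] ->
  #|A| = #|A'| -> #|B| = #|B'| -> iso (blocks A B) (blocks A' B').
Proof.
move=> d d' cA cB; have [f [fi fA fB]] := move_blocks d d' cA cB.
exists f; split=> //; apply/esym/eqP; rewrite eqEcard card_imset; last exact: imset_inj.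
rewrite !card_blocks // cA cB leqnn andbT; apply/subsetP=> _ /imsetP[e + ->].
rewrite !inE card_imset // => /andP[-> /=]; rewrite -fA -fB.
by case/orP=> eX; rewrite (imsetS _ eX) ?orbT.
Qed.

Lemma cometg_iso c A c' (A' : {set 'I_n}) : #|A| = 3 -> #|A'| = 3 -> c \notin A -> c' \notin A' ->
  iso (cometg c A) (cometg c' A').
Proof.
move=> A3 A3' cA cA'.
have d : [disjoint [set c] & A] by rewrite disjoints1.
have d' : [disjoint [set c'] & A'] by rewrite disjoints1.
have [||f [fi fc fA]] := move_blocks d d'; rewrite ?cards1 ?A3 ?A3' //.
have {}fc : f c = c' by apply/set1P; rewrite -fc imset_f // set11.
exists f; split=> //; apply/esym/eqP; rewrite eqEcard card_imset; last exact: imset_inj.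
rewrite !card_cometg // leqnn andbT; apply/subsetP=> _ /imsetP[e + ->].
rewrite !inE card_imset // => /andP[-> /=] /orP[eQ|/andP[ce eA]]; apply/orP; [left|right].
  by rewrite -fc -fA -imsetU1 imsetS.
rewrite -fc imset_f //= -fA -setI_eq0 -imsetI ?imset_eq0 ?setI_eq0 //.
by move=> ? ? _ _; apply: fi.
Qed.

Lemma card_ord_lt k : k <= n -> #|[set i : 'I_n | i < k]| = k.
Proof.
move=> kn; have wi : injective (widen_ord kn) by move=> i j /(congr1 val)/= /val_inj.
rewrite -[RHS]card_ord -(card_imset predT wi).
apply: eq_card => i; rewrite inE; apply/idP/imsetP => [ik|[j _ ->] //=].
by exists (Ordinal ik) => //; apply: val_inj.
Qed.

End Transfer.

Lemma K6_Kn6E n : K6_Kn6 n = blocks [set i : 'I_n | i < 6] [set i : 'I_n | 6 <= i].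
Proof. by []. Qed.

Lemma K6_K6_K1E :
  K6_K6_K1 = blocks [set i : 'I_13 | i < 6] [set i : 'I_13 | 6 <= i < 12].
Proof. by []. Qed.

Definition hub n : {set 'I_n} := [set i : 'I_n | 0 < i < 4].

Lemma cometE n (c : 'I_n) : val c = 0 -> comet n = cometg c (hub n).
Proof.
move=> c0; rewrite /comet.
have -> : [set i : 'I_n | i < 4] = c |: hub n.
  by apply/setP=> i; rewrite !inE -val_eqE /= c0; case: (val i).
have -> : [set i : 'I_n | (val i == 0) || (4 <= i)] = ~: hub n.
  by apply/setP=> i; rewrite !inE; rewrite -[val i]/(nat_of_ord i); case: (nat_of_ord i) => [|[|[|[|k]]]].
apply/setP=> e; rewrite !inE -disjoints_subset; congr (_ && (_ || _ && _)).
apply/exists_inP/idP => [[i ie /eqP i0]|ce]; last by exists c; rewrite ?c0.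
by rewrite (_ : c = i) //; apply: val_inj; rewrite /= c0.
Qed.

(** * Extremal numbers in the three ranges *)

Section Final.
Variable n : nat.
Implicit Types (H : {set {set 'I_n}}) (A B S : {set 'I_n}).

Lemma onT H : on H setT.
Proof. by move=> e _; apply: subsetT. Qed.

Lemma in_comet_sub H : uni3 H -> in_comet setT H ->
  exists c (A : {set 'I_n}), [/\ c \notin A, #|A| = 3 & H \subset cometg c A].
Proof.
move=> uH [c [A [_ _ cA A3 hH]]]; exists c, A; split=> //.
by apply/subsetP=> e eH; rewrite inE uH //= hH.
Qed.

Lemma blocks_match A B : #|A| = 6 -> has_match (blocks A B).
Proof.
move=> A6; have /card_gt0P[e] : 0 < #|K3 A| by rewrite card_K3 A6.
rewrite inE => /andP[eA e3]; exists e, (A :\: e); rewrite !inE e3 eA subsetDl /=.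
rewrite cardsD (setIidPr eA) A6 (eqP e3); split=> //.
by rewrite -setI_eq0; apply/eqP/setP=> t; rewrite !inE; case: (t \in e).
Qed.

Lemma uni3_blocks A B : uni3 (blocks A B).
Proof. by move=> e; rewrite inE => /andP[/eqP]. Qed.

Lemma uni3_cometg c A : uni3 (cometg c A).
Proof. by move=> e; rewrite inE => /andP[/eqP]. Qed.

Lemma cometg_match c A : 6 <= n -> #|A| = 3 -> c \notin A -> has_match (cometg c A).
Proof.
move=> n6 A3 cA; have : #|~: (c |: A)| = n - 4.
  by rewrite cardsCs setCK card_ord cardsU1 cA A3.
move=> cC; have /card_gt0P[x xC] : 0 < #|~: (c |: A)| by rewrite cC; lia.
have : 0 < #|~: (c |: A) :\ x| by have := cardsD1 x (~: (c |: A)); rewrite xC cC; lia.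
case/card_gt0P=> y; rewrite in_setD1 => /andP[yx yC].
move: xC yC; rewrite !inE !negb_or => /andP[xc xA] /andP[yc yA].
exists A, [set c; x; y]; rewrite !inE A3 eqxx subsetUr /=; split=> //; last first.
  by rewrite disjoint_sym -setI_eq0 !setIUl !setU_eq0 !setI_eq0 !disjoints1 cA xA yA.
have xy : x != y by rewrite eq_sym.
rewrite -setUA cardsU1 cards2 !inE negb_or ![c == _]eq_sym xc yc xy eqxx /= setUA.
by rewrite orbC -setI_eq0 !setIUl !setU_eq0 !setI_eq0 !disjoints1 cA xA yA.
Qed.

Lemma dense_blocks H S : uni3 H -> path_free H -> #|S| = 6 -> 14 < #|inside H S| ->
  H \subset blocks S (~: S).
Proof.
move=> uH pH S6 dS; apply/subsetP=> e eH; rewrite inE uH //= -disjoints_subset.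
exact: dense_split dS eH.
Qed.

Lemma disjointC A : [disjoint A & ~: A].
Proof. by rewrite disjoints_subset setCK. Qed.

Lemma cardC6 S : #|S| = 6 -> #|~: S| = n - 6.
Proof. by move=> S6; rewrite cardsCs setCK card_ord S6. Qed.

Lemma small_bound H : 6 <= n <= 12 -> uni3 H -> path_free H -> has_match H ->
  #|H| <= 20 + 'C(n - 6, 3) /\
  (#|H| = 20 + 'C(n - 6, 3) -> exists2 S : {set 'I_n}, #|S| = 6 & H = blocks S (~: S)).
Proof.
move=> n612 uH pH mH; have [sp|[S S6 dS]] := sparse_or_dense H.
  (* No sparse graph is extremal here: [gb n] is smaller for each of the seven values of [n]. *)
  suff lt : #|H| < 20 + 'C(n - 6, 3) by split; [apply: ltnW | move=> h; rewrite h ltnn in lt].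
  have gH : good H by split.
  have le : #|H| <= gb n + (12 < n).
    have := good_bounded _ gH (@onT H) mH; rewrite cardsT card_ord; apply.
    exact: ltnSn.
  apply: leq_ltn_trans le _; case/andP: n612; clear.
  by move: n => m; do 13 (destruct m as [|m]; [by vm_compute|]).
have Hsub := dense_blocks uH pH S6 dS.
have cB : #|blocks S (~: S)| = 20 + 'C(n - 6, 3).
  by rewrite card_blocks ?disjointC // S6 cardC6.
split; first by rewrite -cB; apply: subset_leq_card.
by move=> h; exists S => //; apply/eqP; rewrite eqEcard Hsub cB h leqnn.
Qed.

Lemma large_bound H : 14 <= n -> uni3 H -> path_free H -> has_match H ->
  #|H| <= 4 + 'C(n - 4, 2) /\
  (#|H| = 4 + 'C(n - 4, 2) -> exists c (A : {set 'I_n}), [/\ c \notin A, #|A| = 3 & H = cometg c A]).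
Proof.
move=> n14 uH pH mH; have [sp|[S S6 dS]] := sparse_or_dense H.
  have gH : good H by split.
  case: (good_bound gH (@onT H) mH) => [|/(in_comet_sub uH)[c [A [cA A3 HA]]]].
    rewrite cardsT card_ord /gb => le; suff lt : #|H| < 4 + 'C(n - 4, 2).
      by split; [apply: ltnW | move=> h; rewrite h ltnn in lt].
    (* From 13 vertices on [gb] takes its default value [3 + 'C(n - 4, 2)]. *)
    by move: le; rewrite nth_default // ltnW.
  have cC := card_cometg A3 cA; rewrite card_ord in cC.
  split; first by rewrite -cC; apply: subset_leq_card.
  by move=> h; exists c, A; split=> //; apply/eqP; rewrite eqEcard HA cC h leqnn.
suff lt : #|H| < 4 + 'C(n - 4, 2) by split; [apply: ltnW | move=> h; rewrite h ltnn in lt].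
have := dense_card uH pH (@onT H) S6 dS; rewrite setTD; set K := inside H _ => H20.
have K17 : #|K| + 17 <= 'C(#|~: S| + 2, 2).
  apply: bound8; [exact: uni3_inside | exact: path_free_inside | exact: on_inside |].
  by rewrite cardC6 //; clear -n14; lia.
rewrite cardC6 // (_ : n - 6 + 2 = n - 4) in K17; last by clear -n14; lia.
by move: H20 K17; move: #|H| #|K| 'C(_, _) => h k t; clear; lia.
Qed.

End Final.

(** Both constructions tie at 40. Since [gb 13] is 39, a sparse graph attains it only as a comet;
    with a dense 6-set, equality forces 20 edges on the other seven vertices, and [bound7]
    identifies them. *)
Lemma bound13 (H : {set {set 'I_13}}) : uni3 H -> path_free H -> has_match H ->
  #|H| <= 40 /\ (#|H| = 40 ->
    (exists A B : {set 'I_13}, [/\ [disjoint A & B], #|A| = 6, #|B| = 6 & H = blocks A B]) \/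
    (exists c (A : {set 'I_13}), [/\ c \notin A, #|A| = 3 & H = cometg c A])).
Proof.
move=> uH pH mH; have [sp|[S S6 dS]] := sparse_or_dense H.
  have gH : good H by split.
  case: (good_bound gH (@onT _ H) mH) => [|/(in_comet_sub uH)[c [A [cA A3 HA]]]].
    rewrite cardsT card_ord (_ : gb 13 = 39) // => le.
    by split; [apply: leq_trans le _ | move=> h; rewrite h in le].
  have cC : #|cometg c A| = 40 by rewrite card_cometg // card_ord.
  split; first by rewrite -cC; apply: subset_leq_card.
  by move=> h; right; exists c, A; split=> //; apply/eqP; rewrite eqEcard HA cC h leqnn.
have := dense_card uH pH (@onT _ H) S6 dS; rewrite setTD; set K := inside H _ => H20.
have [K20 Keq] : #|K| <= 20 /\ (#|K| = 20 ->
    exists2 S' : {set 'I_13}, S' \subset ~: S /\ #|S'| = 6 & K = K3 S').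
  apply: bound7; [exact: uni3_inside | exact: path_free_inside | exact: on_inside |].
  by rewrite cardC6.
split; first by apply: leq_trans H20 _; rewrite (leq_add2l 20 _ 20).
move=> h; rewrite h (leq_add2l 20 20) in H20; left.
have [|S' [S'S S'6] KE] := Keq; first by apply/eqP; rewrite eqn_leq K20 H20.
have d : [disjoint S & S'] by rewrite disjoint_sym disjoints_subset.
exists S, S'; split=> //; apply/eqP; rewrite eqEcard card_blocks // S6 S'6 h leqnn andbT.
rewrite {1}(dense_decomp uH pH (@onT _ H) S6 dS) setTD -/K KE blocksE.
by apply: setSU; apply: inside_K3.
Qed.

Theorem mainTheorem5 :
  (* (i) 6 <= n <= 12 *)
  (forall n : nat, 6 <= n <= 12 ->
     (forall H : {set {set 'I_n}}, uniform3 H -> Pfree H -> contains Mmatch H ->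
        #|H| <= 20 + 'C(n - 6, 3)) /\
     (forall H : {set {set 'I_n}}, uniform3 H ->
        ((Pfree H /\ contains Mmatch H /\ #|H| = 20 + 'C(n - 6, 3)) <->
         iso (K6_Kn6 n) H))) /\
  (* (ii) n = 13 *)
  ((forall H : {set {set 'I_13}}, uniform3 H -> Pfree H -> contains Mmatch H ->
        #|H| <= 40) /\
   (forall H : {set {set 'I_13}}, uniform3 H ->
        ((Pfree H /\ contains Mmatch H /\ #|H| = 40) <->
         (iso K6_K6_K1 H \/ iso (comet 13) H)))) /\
  (* (iii) n >= 14 *)
  (forall n : nat, 14 <= n ->
     (forall H : {set {set 'I_n}}, uniform3 H -> Pfree H -> contains Mmatch H ->
        #|H| <= 4 + 'C(n - 4, 2)) /\
     (forall H : {set {set 'I_n}}, uniform3 H ->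
        ((Pfree H /\ contains Mmatch H /\ #|H| = 4 + 'C(n - 4, 2)) <->
         iso (comet n) H))).
Proof.
have low n : 6 <= n -> #|[set i : 'I_n | i < 6]| = 6 by apply: card_ord_lt.
have lowC n : [set i : 'I_n | 6 <= i] = ~: [set i : 'I_n | i < 6].
  by apply/setP=> i; rewrite !inE -leqNgt.
have hub3 n : 4 <= n -> #|hub n| = 3.
  move=> n4; have n1 : 1 <= n by apply: leq_trans n4.
  rewrite (_ : hub n = [set i : 'I_n | i < 4] :\: [set i : 'I_n | i < 1]).
    rewrite cardD_sub ?card_ord_lt //; apply/subsetP=> i; rewrite !inE => i1.
    exact: leq_trans i1 _.
  by apply/setP=> i; rewrite !inE -leqNgt.
have comet_iso n (H : {set {set 'I_n}}) : 6 <= n -> uni3 H ->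
    (exists c (A : {set 'I_n}), [/\ c \notin A, #|A| = 3 & H = cometg c A]) <-> iso (comet n) H.
  move=> n6 uH; have n0 : 0 < n by apply: leq_trans n6.
  pose z := Ordinal n0; have zh : z \notin hub n by rewrite inE.
  have h3 : #|hub n| = 3 by apply: hub3; apply: leq_trans n6.
  rewrite (cometE (c := z)) //; split=> [[c [A [cA A3 ->]]]|[f [fi ->]]].
    exact: cometg_iso.
  exists (f z), (f @: hub n); split; last 1 first.
  - apply/eqP; rewrite eqEcard card_imset; last exact: imset_inj.
    have fz : f z \notin f @: hub n by rewrite mem_imset.
    rewrite !card_cometg ?card_imset // leqnn andbT; apply/subsetP=> _ /imsetP[e + ->].
    rewrite !inE card_imset // => /andP[-> /=] /orP[eQ|/andP[ce eA]]; apply/orP; [left|right].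
      by rewrite -imsetU1 imsetS.
    rewrite imset_f //= -setI_eq0 -imsetI ?imset_eq0 ?setI_eq0 //.
    by move=> ? ? _ _; apply: fi.
  - by rewrite mem_imset.
  by rewrite card_imset.
have comet_props n (H : {set {set 'I_n}}) : 6 <= n -> iso (comet n) H ->
    [/\ Pfree H, contains Mmatch H & #|H| = 4 + 'C(n - 4, 2)].
  move=> n6; have n0 : 0 < n by apply: leq_trans n6.
  pose z := Ordinal n0; have zh : z \notin hub n by rewrite inE.
  have h3 : #|hub n| = 3 by apply: hub3; apply: leq_trans n6.
  rewrite (cometE (c := z)) // => /iso_sym_props[].
  - exact: uni3_cometg.
  - exact: cometg_path_free.
  - exact: cometg_match.
  by move=> h1 h2 ->; split=> //; rewrite card_cometg // card_ord.
split; [|split].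
- move=> n n612; have n6 : 6 <= n by case/andP: n612.
  have main H uH PH mH := small_bound n612 uH (@Pfree_path_free n H uH PH) (contains_match mH).
  split=> [H uH PH mH|H uH]; first by have [] := main H uH PH mH.
  rewrite K6_Kn6E lowC; split=> [[PH [mH cH]]|].
    have [_ /(_ cH)[S S6 ->]] := main H uH PH mH.
    by apply: blocks_iso; rewrite ?disjointC ?cardC6 ?low.
  case/iso_sym_props.
  - exact: uni3_blocks.
  (* The bound [n <= 12] keeps the second block at no more than six vertices. *)
  - apply: blocks_path_free; rewrite ?disjointC ?low // cardC6 ?low // leq_subLR.
    by case/andP: n612.
  - by apply: blocks_match; apply: low.
  by move=> h1 h2 ->; rewrite card_blocks ?disjointC // cardC6 ?low.
- have main H uH PH mH := bound13 uH (@Pfree_path_free 13 H uH PH) (contains_match mH).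
  split=> [H uH PH mH|H uH]; first by have [] := main H uH PH mH.
  set A := [set i : 'I_13 | i < 6]; set B := [set i : 'I_13 | 6 <= i < 12].
  have A6 : #|A| = 6 by apply: low.
  have BE : B = [set i : 'I_13 | i < 12] :\: A.
    by apply/setP=> i; rewrite !inE -leqNgt.
  have B6 : #|B| = 6.
    rewrite BE cardD_sub ?A6 ?card_ord_lt //; apply/subsetP=> i; rewrite !inE => i6.
    exact: leq_trans i6 _.
  have AB : [disjoint A & B].
    by rewrite -setI_eq0; apply/eqP/setP=> i; rewrite !inE ltnNge; case: (6 <= i).
  rewrite K6_K6_K1E; split=> [[PH [mH cH]]|[|/comet_props[]//]].
    have [_ /(_ cH)[[A' [B' [d A'6 B'6 ->]]]|co]] := main H uH PH mH.
      by left; apply: blocks_iso; rewrite ?A6 ?B6 ?A'6 ?B'6.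
    by right; apply/comet_iso.
  case/iso_sym_props.
  - exact: uni3_blocks.
  - by apply: blocks_path_free; rewrite ?A6 ?B6.
  - exact: blocks_match.
  by move=> h1 h2 ->; rewrite card_blocks // A6 B6.
move=> n n14; have n6 : 6 <= n by apply: leq_trans n14.
have main H uH PH mH := large_bound n14 uH (@Pfree_path_free n H uH PH) (contains_match mH).
split=> [H uH PH mH|H uH]; first by have [] := main H uH PH mH.
split=> [[PH [mH cH]]|/comet_props[]//].
by have [_ /(_ cH)co] := main H uH PH mH; apply/comet_iso.
Qed.
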